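(* Let $n\ge 4$ and let $\mathcal{T}=(V,E)$ be a 4-uniform hypergraph with $|V|=n$ vertices and $|E|=n-3$ hyperedges. Then for any three distinct vertices $v_1,v_2,v_3\in V$, the cross-ratio degree $d_{\mathcal{T}}$ of $\mathcal{T}$ satisfies $$d_{\mathcal{T}}\le P\bigl(G_{\mathcal{T}}-\{v_1,v_2,v_3\}\bigr),$$ where $G_{\mathcal{T}}-\{v_1,v_2,v_3\}$ is the bipartite graph obtained from the incidence graph $G_{\mathcal{T}}$ by deleting the vertices $v_1,v_2,v_3$, and $P(G)$ denotes the number of perfect matchings of a bipartite graph $G$.
   Context: Everything is over $\mathbb{C}$. A 4-uniform hypergraph $\mathcal{T}=(V,E)$ consists of a finite vertex set $V$ and a finite family $E$ of hyperedges, each a 4-element subset of $V$; repeated hyperedges are allowed (i.e. $E$ is an indexed family of 4-element subsets). The cross-ratio of distinct points $z_1,z_2,z_3,z_4\in\mathbb{P}^1$ is $\mathrm{CR}(z_1,z_2,z_3,z_4)=\frac{(z_3-z_1)(z_4-z_2)}{(z_3-z_2)(z_4-z_1)}\in\mathbb{C}\setminus\{0,1\}$, extended as usual when one of the points is $\infty$. $M_{0,n}$ denotes the $(n-3)$-dimensional variety parametrizing $n$-tuples of distinct points of $\mathbb{P}^1$ (labeled by $V$) up to Möbius transformation. Cross-ratio degree: identify $V=\{1,\ldots,n\}$, list the hyperedges as $e_1,\ldots,e_{n-3}$, and choose an ordering $e_i=(v_{i,1},v_{i,2},v_{i,3},v_{i,4})$ of each. Define $\mathrm{CR}_{\mathcal{T}}:M_{0,n}\to(\mathbb{C}\setminus\{0,1\})^{n-3}$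 by $$(z_1,\ldots,z_n)\mapsto\bigl(\mathrm{CR}(z_{v_{i,1}},z_{v_{i,2}},z_{v_{i,3}},z_{v_{i,4}})\bigr)_{i=1,\ldots,n-3}.$$ The source and target have the same dimension $n-3$, and $d_{\mathcal{T}}\in\mathbb{Z}_{\ge0}$ is the degree of $\mathrm{CR}_{\mathcal{T}}$, i.e. the number of points in the fiber over a general point (equal to $0$ if the map is not dominant). It does not depend on the choices of orderings. Incidence graph: $G_{\mathcal{T}}=(V\sqcup E,I)$ is the bipartite graph with vertex set $V\sqcup E$ and edge set $I=\{(v,e)\in V\times E:v\in e\}$. A perfect matching in a bipartite graph $G=(A\sqcup B,I)$ is a bijection $f:A\to B$ with $(a,f(a))\in I$ for all $a\in A$. *)

(* Defs.v *)
From mathcomp Require Import all_boot all_algebra.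
From mathcomp Require Import boolp classical_sets functions cardinality.
From mathcomp Require Import reals complex mpoly.

Set Implicit Arguments.
Unset Strict Implicit.
Unset Printing Implicit Defensive.

Import GRing.Theory.

Local Open Scope classical_set_scope.
Local Open Scope ring_scope.
Local Open Scope card_scope.

(* Hyperedges are indexed by E, so a 4-subset may occur several times. *)
Record hypergraph4 (V E : finType) := Hypergraph4 {
  hedge :> E -> {set V};
  card_hedge : forall e, #|hedge e| = 4%N
}.

Definition edge_ordering (V E : finType) (T : hypergraph4 V E)
    (o : E -> 4.-tuple V) : Prop :=
  forall e, uniq (o e) /\ o e =i T e.

Section ProjectiveLine.
Variable K : fieldType.

(* None is the point at infinity. *)
Definition P1 := option K.

(* If one point is infinite, the two factors containing it cancel in the
   limit.  The value is junk if two or more points are infinite. *)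
Definition cross_ratio (p1 p2 p3 p4 : P1) : K :=
  match p1, p2, p3, p4 with
  | Some z1, Some z2, Some z3, Some z4 =>
      ((z3 - z1) * (z4 - z2)) / ((z3 - z2) * (z4 - z1))
  | None, Some z2, Some z3, Some z4 => (z4 - z2) / (z3 - z2)
  | Some z1, None, Some z3, Some z4 => (z3 - z1) / (z4 - z1)
  | Some z1, Some z2, None, Some z4 => (z4 - z2) / (z4 - z1)
  | Some z1, Some z2, Some z3, None => (z3 - z1) / (z3 - z2)
  | _, _, _, _ => 0
  end.

(* z |-> (a z + b) / (c z + d) *)
Definition moebius (a b c d : K) (p : P1) : P1 :=
  match p with
  | Some z => if c * z + d == 0 then None else Some ((a * z + b) / (c * z + d))
  | None => if c == 0 then None else Some (a / c)
  end.

Variable V : finType.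

Definition moebius_equiv (z w : V -> P1) : Prop :=
  exists a b c d : K, a * d - b * c != 0 /\ forall v, w v = moebius a b c d (z v).

(* A point of M_{0,V} is the Moebius class of an injective V -> P1. *)
Definition moduli_class (z : V -> P1) : set (V -> P1) :=
  [set w : V -> P1 | moebius_equiv z w].

Definition M0 : set (set (V -> P1)) :=
  [set moduli_class z | z in [set z : V -> P1 | injective z]].

Variables (E : finType) (o : E -> 4.-tuple V).

Definition cr_map (z : V -> P1) (e : E) : K :=
  cross_ratio (z (tnth (o e) (inord 0))) (z (tnth (o e) (inord 1)))
              (z (tnth (o e) (inord 2))) (z (tnth (o e) (inord 3))).

(* Cross-ratios of distinct points are Moebius-invariant, so cr_map is constant
   on the classes in M0 and the choice of the representative z is immaterial. *)
Definition cr_fiber (lam : E -> K) : set (set (V -> P1)) :=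
  [set x | M0 x /\ exists2 z, x z & cr_map z =1 lam].

(* For K the complex numbers, d is the degree of CR : M0 -> (K \ {0,1})^E when
   all fibers over some nonempty principal open subset of the target have
   exactly d points.  The map is not dominant iff this holds with d = 0. *)
Definition is_cr_degree (d : nat) : Prop :=
  exists2 F : {mpoly K[#|E|]}, F != 0 &
    forall lam : E -> K,
      (forall e, lam e != 0 /\ lam e != 1) ->
      F.@[fun i => lam (enum_val i)] != 0 ->
      cr_fiber lam #= `I_d.

End ProjectiveLine.

Definition bigraph (A B : finType) := A -> B -> bool.

Definition perfect_matching (A B : finType) (G : bigraph A B)
    (f : {ffun A -> B}) : bool :=
  [&& injectiveb f, [forall b, b \in codom f] & [forall a, G a (f a)]].

Definition num_perfect_matchings (A B : finType) (G : bigraph A B) : nat :=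
  #|[pred f | perfect_matching G f]|.

Definition incidence_graph (V E : finType) (T : hypergraph4 V E) : bigraph V E :=
  fun v e => v \in T e.

Definition delete_left (A B : finType) (G : bigraph A B) (S : {set A}) :
    bigraph {a : A | a \notin S} B :=
  fun a b => G (val a) b.
Arguments delete_left {A B} G S _ _.

(* Main.v *)
From HB Require Import structures.
Require Import Defs.
From mathcomp Require Import all_boot all_algebra.
From mathcomp Require Import boolp classical_sets functions cardinality.
From mathcomp Require Import generic_quotient fraction mpoly reals complex.
From mathcomp Require Import ring zify.

(** Put v1, v2, v3 at infinity, 0 and 1.  The remaining n - 3 points become affine
    coordinates x_v, and each cross-ratio lam_e becomes a quotient of two forms
    that are multilinear in the coordinates x_v with v in e.  Fixing the values of
    the lam_e is thus a system of n - 3 multilinear equations in n - 3 variables,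
    and the theorem is the corresponding multihomogeneous Bezout bound: the mixed
    volume of the supports is the permanent of the incidence matrix, that is, the
    number of perfect matchings.

    The bound is proved for field degrees, in L = C(x_v) over C(lam_e), by
    expanding the permanent along a row.  Forget one equation e and let F be
    generated by the other lam.  Then L is a function field of one variable over F,
    and the degree of lam_e is at most the sum over v in e of the degrees of the
    x_v ([degree_multilinear]).  This replaces the count of poles on a curve by a
    count of dimensions: D elements independent over F(lam_e) produce D (N + 1)
    elements independent over F inside the space of functions of degree at most N
    in each x_v.  After a projective change of each coordinate every monomial
    reduces to monomials with a single large exponent ([box_reduction]), so this
    space has dimension at most N times the sum of the degrees, up to a constant.
    The degree of x_v over F is the degree of the system without the equation e
    and the variable x_v, over the base field enlarged by x_v; induction gives
    [degree_le_matchings].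

    It remains to compare fibers with field degrees.  If d > 0, general values of
    lam are attained, so the lam_e are algebraically independent
    ([alg_indep_generic]).  A linear form that separates the d points of a general
    fiber has d powers independent over C(lam), since a relation between them would
    specialize to a nonzero polynomial of degree less than d with d roots
    ([separating_powers]). *)

Set Implicit Arguments.
Unset Strict Implicit.
Unset Printing Implicit Defensive.
Import GRing.Theory.

(** * Generated subfields and algebraic dependence *)

Section Gen.
Local Open Scope classical_set_scope.
Local Open Scope ring_scope.
Variable L : fieldType.
Implicit Types (A B M : set L) (x y : L).

Definition is_subfield M :=
  [/\ M 1, forall x y, M x -> M y -> M (x - y) & forall x y, M x -> M y ->
    M (x / y)].

(** The subfield of L generated by A.  Membership is a boolean predicate so that
    the closure lemmas for divring-closed predicates and polyOver apply to it. *)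
Definition gen A : {pred L} :=
  fun x => `[< forall M, is_subfield M -> A `<=` M -> M x >].

Lemma gen_divring A : divring_closed (gen A).
Proof.
split.
- by apply/asboolP => M [].
- move=> x y /asboolP hx /asboolP hy; apply/asboolP => M hM AM.
  by case: (hM) => _ h _; apply: h; [apply: hx | apply: hy].
- move=> x y /asboolP hx /asboolP hy; apply/asboolP => M hM AM.
  by case: (hM) => _ _ h; apply: h; [apply: hx | apply: hy].
Qed.

HB.instance Definition _ A := GRing.isDivringClosed.Build L (gen A) (gen_divring A).

Lemma gen_min A M : is_subfield M -> A `<=` M -> forall x, x \in gen A -> M x.
Proof. by move=> hM AM x /asboolP; apply. Qed.

Lemma mem_gen A x : A x -> x \in gen A.
Proof. by move=> Ax; apply/asboolP => M _; apply. Qed.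

Lemma gen_subfield A : is_subfield (fun x => x \in gen A).
Proof. by split=> [|x y|x y];
  [exact: rpred1 | exact: rpredB | exact: rpred_div]. Qed.

Lemma gen_sub A B : (forall x, A x -> x \in gen B) -> {subset gen A <= gen B}.
Proof. move=> h x; exact: (gen_min (gen_subfield B)). Qed.

Lemma gen_mono A B : A `<=` B -> {subset gen A <= gen B}.
Proof. by move=> AB; apply: gen_sub => x /AB; exact: mem_gen. Qed.

(** The same subfield as a type, needed to do matrix algebra over it and to use
    the theory of algebraic elements over a field morphism. *)
Record genT A := GenT { gen_val : L; gen_valP : gen_val \in gen A }.
HB.instance Definition _ A := [isSub for @gen_val A].
HB.instance Definition _ A := [Choice of genT A by <:].
HB.instance Definition _ A := [SubChoice_isSubIntegralDomain of genT A by <:].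
HB.instance Definition _ A := [SubIntegralDomain_isSubField of genT A by <:].


Definition alg A x := algebraicOver (val : genT A -> L) x.

Lemma gen_liftP A (p : {poly L}) :
  p \is a polyOver (gen A) -> exists q : {poly genT A}, p = map_poly val q.
Proof.
move=> /polyOverP pA; exists (\poly_(i < size p) GenT (pA i)).
apply/polyP => i; rewrite coef_map coef_poly; case: ltnP => //= le_pi.
by rewrite nth_default.
Qed.

Lemma algP A x :
  alg A x <-> exists p : {poly L}, [/\ p != 0, p \is a polyOver (gen A) & root p x].
Proof.
split=> [[p p0 px]|[p [p0 /gen_liftP[q pE] px]]].
  exists (map_poly val p); split => //; first by rewrite map_poly_eq0.
  by apply/polyOverP => i; rewrite coef_map; apply: valP.
exists q; last by rewrite -pE.
by move: p0; rewrite pE map_poly_eq0.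
Qed.

Lemma alg_subfield A : is_subfield (alg A).
Proof.
split=> [|x y|x y]; [exact: algebraic1|exact: algebraic_sub|exact: algebraic_div].
Qed.

Lemma gen_alg A x : x \in gen A -> alg A x.
Proof. by move=> xA; have := algebraic_id (val : {rmorphism genT A ->
  L}) (GenT xA). Qed.

(** Coefficients of a relation over B are themselves algebraic over A, and roots
    of polynomials with algebraic coefficients are algebraic. *)
Lemma alg_trans A B x : (forall b, B b -> alg A b) -> alg B x -> alg A x.
Proof.
move=> BA /algP[p [p0 pB px]]; apply/integral_algebraic.
apply: (integral_root p0 px) => z zp; apply/integral_algebraic.
apply: (gen_min (alg_subfield A) BA).
by have /polyOverP pB' := pB; case/(nthP 0): zp => i _ <-.
Qed.

Lemma alg_mono A B x : A `<=` B -> alg A x -> alg B x.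
Proof. by move=> AB; apply: alg_trans => a /AB/mem_gen/gen_alg. Qed.

Definition is_ring M :=
  [/\ M 1, forall x y, M x -> M y -> M (x - y) & forall x y, M x -> M y ->
    M (x * y)].

Definition fracs M : set L := [set x | exists a b, [/\ M a, M b, b != 0 & x = a /
  b]].

Lemma fracs_subfield M : is_ring M -> is_subfield (fracs M).
Proof.
move=> [M1 MB MM]; split.
- by exists 1, 1; rewrite oner_eq0 divr1.
- move=> _ _ [a [b [Ma Mb b0 ->]]] [c [d [Mc Md d0 ->]]].
  exists (a * d - c * b), (b * d); split; [|exact: MM|by rewrite mulf_neq0|].
    by apply: MB; apply: MM.
  by rewrite -mulNr addf_div // mulNr.
- move=> _ _ [a [b [Ma Mb b0 ->]]] [c [d [Mc Md d0 ->]]].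
  have M0 : M 0 by rewrite -(subrr 1); apply: MB.
  have [->|c0] := eqVneq c 0.
    by exists 0, 1; rewrite oner_eq0 mul0r invr0 mulr0 mul0r.
  exists (a * d), (b * c); split; [exact: MM|exact: MM|by rewrite mulf_neq0|].
  by rewrite invf_div mulf_div.
Qed.

(** A finite family of quotients has a common denominator. *)
Lemma fracs_common M (s : seq L) : is_ring M -> (forall x, x \in s -> fracs M x) ->
  exists b, [/\ M b, b != 0 & forall x, x \in s -> M (x * b)].
Proof.
move=> [M1 MB MM]; elim: s => [|x s IH] hs; first by exists 1; rewrite oner_eq0.
have [b [Mb b0 hb]] := IH (fun y ys => hs y (mem_behead (s := x :: s) ys)).
have [a [c [Ma Mc c0 xE]]] := hs x (mem_head _ _).
exists (b * c); split; [exact: MM|by rewrite mulf_neq0|].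
move=> y; rewrite inE => /predU1P[->|/hb ?]; last by rewrite mulrA; apply: MM.
by rewrite xE mulrCA divfK // mulrC; apply: MM.
Qed.

Definition poly_values A x : set L :=
  [set y | exists2 p : {poly L}, p \is a polyOver (gen A) & y = p.[x]].

Lemma poly_values_ring A x : is_ring (poly_values A x).
Proof.
split.
- by exists 1; rewrite ?rpred1 ?hornerE.
- by move=> _ _ [p ? ->] [q ? ->]; exists (p - q); rewrite ?rpredB ?hornerE.
- by move=> _ _ [p ? ->] [q ? ->]; exists (p * q); rewrite ?rpredM ?hornerE.
Qed.

Lemma gen_add1 A x y : y \in gen (x |` A) -> fracs (poly_values A x) y.
Proof.
apply: gen_min; first exact/fracs_subfield/poly_values_ring.
move=> z /= zE; exists z, 1; rewrite oner_eq0 divr1; split=> //;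
  last by exists 1; rewrite ?rpred1 ?hornerE.
case: zE => [->|/mem_gen zA]; first by exists 'X; rewrite ?polyOverX ?hornerE.
by exists z%:P; rewrite ?polyOverC ?hornerE.
Qed.

Definition alg_dependent A x y := exists P : {poly {poly L}},
  [/\ P != 0, P \is a polyOver (polyOver (gen A)) & P.[x%:P].[y] = 0].

Lemma alg_dependent_sym A x y : alg_dependent A x y -> alg_dependent A y x.
Proof.
move=> [P [P0 PA Pxy]]; exists (swapXY P); split; first by rewrite swapXY_eq0.
  apply/polyOverP => i; apply/polyOverP => j; rewrite coef_swapXY.
  by have /polyOverP/(_ j)/polyOverP/(_ i) := PA.
by rewrite horner2_swapXY.
Qed.

Lemma horner2E (P : {poly {poly L}}) x y :
  P.[x%:P].[y] = (map_poly (horner_eval y) P).[x].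
Proof. by rewrite -{2}(hornerC x y) -[_.[x%:P].[y]]/(horner_eval y _) -horner_map /= horner_evalE. Qed.

(** Clearing denominators in the minimal equation of x over A(y) yields a
    polynomial relation in two variables over A. *)
Lemma alg_alg_dependent A x y : alg (y |` A) x -> alg_dependent A x y.
Proof.
move=> /algP[p [p0 /polyOverP pA px]].
have /(fracs_common (poly_values_ring A y))[b [_ b0 hb]] : forall c, c \in (p :
  seq L) -> fracs (poly_values A y) c.
  by move=> c /(nthP 0)[i _ <-]; apply: gen_add1.
have /choice[q hq] : forall i, exists q : {poly L},
  q \is a polyOver (gen A) /\ p`_i * b = q.[y].
  move=> i; case: (ltnP i (size p)) => [lt_ip|le_pi].
    by have [q] := hb _ (mem_nth 0 lt_ip); exists q.
  by exists 0; rewrite rpred0 nth_default // mul0r hornerE.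
exists (\poly_(i < size p) q i); split.
- apply/eqP => /polyP/(_ (size p).-1); rewrite coef_poly coef0.
  rewrite prednK ?size_poly_gt0 // leqnn => q0.
  have := (hq (size p).-1).2; rewrite q0 hornerE => /eqP.
  by rewrite mulf_eq0 (negPf b0) orbF -lead_coefE lead_coef_eq0 (negPf p0).
- apply/polyOverP => i; rewrite coef_poly; case: ifP => _; last exact: rpred0.
  by have [] := hq i.
- rewrite horner2E; have -> : map_poly (horner_eval y) (\poly_(i < size p) q i) =
    b *: p.
    apply/polyP => i; rewrite coef_map coefZ coef_poly /=; case: ltnP => [_|le_pi].
      by rewrite [b * _]mulrC (hq i).2.
    by rewrite [p`_i]nth_default // mulr0 rmorph0.
  by rewrite hornerZ (rootP px) mulr0.
Qed.

(** A relation between x and y specializes to an equation for x over A(y); it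
    does not become trivial, since a nonzero leading coefficient, a polynomial
    over A, cannot vanish at the transcendental element y. *)
Lemma alg_dependent_alg A x y : ~ alg A y -> alg_dependent A x y -> alg (y |` A) x.
Proof.
move=> yA [P [P0 /polyOverP PA Pxy]]; apply/algP;
  exists (map_poly (horner_eval y) P); split.
- apply/eqP => Py0; case: yA; apply/algP; exists (lead_coef P);
    rewrite lead_coef_eq0; split=> //; first exact: PA.
  rewrite rootE lead_coefE; have /polyP/(_ (size P).-1) := Py0;
    by rewrite coef_map coef0 => /eqP.
- apply/polyOverP => i; rewrite coef_map /= /horner_eval.
  apply: rpred_horner; last by apply: mem_gen; left.
  by apply: polyOverS (PA i); apply: gen_mono => z; right.
- by rewrite rootE -horner2E Pxy.
Qed.

(** The exchange property of algebraic dependence: the relation between x and y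
    can be read in either variable. *)
Lemma alg_exchange A x y : alg (x |` A) y -> ~ alg A y -> alg (y |` A) x.
Proof. by move=> /alg_alg_dependent/alg_dependent_sym h yA;
  apply: alg_dependent_alg. Qed.

End Gen.

(** * Linear algebra over a subfield, and growth of filtered spaces *)

Section Span.
Local Open Scope classical_set_scope.
Local Open Scope ring_scope.
Variable L : fieldType.
Implicit Types (A B M W : set L) (x y : L).

Definition is_subspace A M :=
  [/\ M 0, forall x y, M x -> M y -> M (x + y) &
      forall c x, c \in gen A -> M x -> M (c * x)].

Definition span A W : set L :=
  [set x | forall M, is_subspace A M -> W `<=` M -> M x].

Lemma span_subspace A W : is_subspace A (span A W).
Proof.
split.
- by move=> M [].
- by move=> x y hx hy M hM WM; case: (hM) => _ h _; apply: h; [apply: hx|apply: hy].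
- by move=> c x cA hx M hM WM; case: (hM) => _ _ h; apply: h => //; apply: hx.
Qed.

Lemma span0 A W : span A W 0.
Proof. by case: (span_subspace A W). Qed.
Lemma spanD A W x y : span A W x -> span A W y -> span A W (x + y).
Proof. by case: (span_subspace A W) => _ h _; apply: h. Qed.
Lemma spanZ A W c x : c \in gen A -> span A W x -> span A W (c * x).
Proof. by case: (span_subspace A W) => _ _ h; apply: h. Qed.
Lemma span_sum A W (I : Type) (r : seq I) (P : pred I) (f : I -> L) :
  (forall i, P i -> span A W (f i)) -> span A W (\sum_(i <- r | P i) f i).
Proof. by move=> h; elim/big_rec: _ => [|i x Pi]; [exact: span0|apply: spanD;
  exact: h]. Qed.

Lemma span_mem A W x : W x -> span A W x.
Proof. by move=> Wx M _; apply. Qed.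

Lemma span_ind A W M x : is_subspace A M -> W `<=` M -> span A W x -> M x.
Proof. by move=> hM WM; apply. Qed.

Lemma span_sub A W W' : (forall w, W w -> span A W' w) -> span A W `<=` span A W'.
Proof. by move=> h x; apply: span_ind => //; exact: span_subspace. Qed.

Lemma span_mono A W W' : W `<=` W' -> span A W `<=` span A W'.
Proof. by move=> h; apply: span_sub => w /h; exact: span_mem. Qed.

Lemma span_mull A W W' z x :
  (forall w, W w -> span A W' (z * w)) -> span A W x -> span A W' (z * x).
Proof.
move=> h; apply: (span_ind (M := fun x => span A W' (z * x))) => //.
split; first by rewrite mulr0; exact: span0.
- by move=> a b ha hb; rewrite mulrDr; apply: spanD.
- by move=> c a cA ha; rewrite mulrCA; apply: spanZ.
Qed.

Lemma span_mul A W W' W'' x y :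
  (forall v w, W v -> W' w -> span A W'' (v * w)) ->
  span A W x -> span A W' y -> span A W'' (x * y).
Proof.
move=> h hx hy; rewrite mulrC; apply: span_mull hx => v Wv.
by rewrite mulrC; apply: span_mull hy => w W'w; apply: h.
Qed.

Lemma span_seqP A (s : seq L) x : span A [set` s] x ->
  exists2 c : 'I_(size s) -> L, (forall i, c i \in gen A) &
    x = \sum_i c i * s`_i.
Proof.
pose M x := exists2 c : 'I_(size s) -> L, (forall i, c i \in gen A) &
    x = \sum_i c i * s`_i.
apply: (span_ind (M := M)); last first.
  move=> w /= /(nthP 0)[i lt_is <-].
  exists (fun j => ((j : nat) == i)%:R) => [j|]; first by rewrite rpred_nat.
  rewrite (bigD1 (Ordinal lt_is)) //= eqxx mul1r big1 ?addr0 // => j.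
  by rewrite -val_eqE /= => /negPf->; rewrite mul0r.
split.
- exists (fun=> 0) => [i|]; first exact: rpred0.
  by rewrite big1 // => i _; rewrite mul0r.
- move=> _ _ [c cA ->] [d dA ->]; exists (fun i => c i + d i) => [i|];
    first exact: rpredD.
  by rewrite -big_split; apply: eq_bigr => i _; rewrite mulrDl.
- move=> a _ aA [c cA ->]; exists (fun i => a * c i) => [i|]; first exact: rpredM.
  by rewrite mulr_sumr; apply: eq_bigr => i _; rewrite mulrA.
Qed.

Definition lin_indep A (I : finType) (u : I -> L) :=
  forall c : I -> L, (forall i, c i \in gen A) -> \sum_i c i * u i = 0 ->
    forall i, c i = 0.

(** Otherwise the coordinate matrix has more rows than columns, and a nonzero
    row of its left kernel is a linear relation. *)
Lemma lin_indep_span_le A (I : finType) (u : I -> L) (s : seq L) :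
  lin_indep A u -> (forall i, span A [set` s] (u i)) -> (#|I| <= size s)%N.
Proof.
move=> iu us; rewrite leqNgt; apply/negP => lt_sI.
have /choice[c hc] : forall i, exists c : 'I_(size s) -> L,
    (forall j, c j \in gen A) /\ u i = \sum_j c j * s`_j.
  by move=> i; have [c] := span_seqP (us i); exists c.
pose M : 'M[genT A]_(#|I|, size s) := \matrix_(i, j) GenT ((hc (enum_val i)).1 j).
have : kermx M != 0.
  rewrite kermx_eq0 -row_leq_rank -ltnNge; apply: leq_ltn_trans lt_sI.
  exact: rank_leq_col.
case/rowV0Pn => v /sub_kermxP vM; apply/negP; rewrite negbK; apply/eqP/rowP => k.
apply: val_inj; rewrite mxE /=.
rewrite -[k]enum_valK; apply: (iu (fun i => val (v 0 (enum_rank i)))) => [i|];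
  first exact: valP.
under eq_bigr => i _ do rewrite (hc i).2 mulr_sumr.
rewrite exchange_big big1 // => j _.
have /matrixP/(_ 0 j)/(congr1 val) := vM; rewrite !mxE rmorph_sum /= =>
  /(congr1 (fun z => z * s`_j)).
rewrite mul0r mulr_suml => h;
  rewrite -[RHS]h [RHS](reindex_onto (@enum_rank I) (@enum_val I I)) /=; last first.
  by move=> i _; rewrite enum_valK.
apply: eq_big => [i|i _]; first by rewrite enum_rankK eqxx.
by rewrite mulrA mxE /= enum_rankK.
Qed.

(** Multiplicativity of degrees in the form used for counting: independence over
    A(y) with y transcendental over A gives independent products with the
    powers of y. *)
Lemma lin_indep_powers A (I : finType) (u : I -> L) y n :
  ~ alg A y -> lin_indep (y |` A) u ->
  lin_indep A (fun k : I * 'I_n => u k.1 * y ^+ k.2).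
Proof.
move=> yA iu c cA c0 [i b].
pose p i := \poly_(j < n) (if insub j is Some b then c (i, b) else 0).
have pA k : p k \is a polyOver (gen A).
  apply/polyOverP => j; rewrite coef_poly; case: ifP => _; last exact: rpred0.
  by case: insub => [a|]; [exact: cA|exact: rpred0].
have py k : (p k).[y] = \sum_b c (k, b) * y ^+ b.
  by rewrite horner_poly; apply: eq_bigr => j _; rewrite valK.
have p0 : (p i).[y] = 0.
  apply: (iu (fun k => (p k).[y])) => [k|].
    apply: rpred_horner; last by apply: mem_gen; left.
    by apply: polyOverS (pA k); apply: gen_mono => z; right.
  rewrite -[RHS]c0; transitivity (\sum_k \sum_(b < n) c (k, b) * (u k * y ^+ b)).
    apply: eq_bigr => k _; rewrite py mulr_suml; apply: eq_bigr => j _.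
    by rewrite mulrA mulrAC.
  by rewrite pair_bigA; apply: eq_bigr => -[].
have : p i = 0.
  apply/eqP; apply: contra_notT yA => pi0; apply/algP; exists (p i); split=> //.
  exact/rootP.
move/polyP/(_ b); rewrite coef_poly ltn_ord valK coef0; done.
Qed.

(** A maximal independent family generates. *)
Lemma basis_exists A r :
  (forall D (u : 'I_D -> L), lin_indep A u -> (D <= r)%N) ->
  exists2 s : seq L, (size s <= r)%N & forall y, span A [set` s] y.
Proof.
move=> hr.
(* Sizes of independent families, bounded by r. *)
pose P n := `[< exists2 s : seq L, size s = n & lin_indep A (fun i :
  'I_(size s) => s`_i) >].
have P0 : exists n, P n.
  by exists 0%N; apply/asboolP; exists [::] => // c _ _ [].
have Pr n : P n -> (n <= r)%N by move=> /asboolP[s <- /hr].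
case: (ex_maxnP P0 Pr) => n /asboolP[s sn is_] nmax.
exists s => [|y]; first exact: hr is_.
apply: contrapT => ys.
have : P n.+1; last by move/nmax; rewrite ltnn.
apply/asboolP; exists (y :: s); first by rewrite /= sn.
move=> c cA; rewrite big_ord_recl /= => c0.
have c00 : c ord0 = 0.
  apply/eqP; apply: contra_notT ys => c00.
  have -> : y = \sum_(i < size s) (- (c ord0)^-1 * c (lift ord0 i)) * s`_i.
    under eq_bigr => i _ do rewrite -mulrA.
    rewrite -mulr_sumr; apply: (mulfI c00); rewrite mulrA mulrN mulfV // mulN1r.
    by apply/eqP; rewrite -addr_eq0; apply/eqP.
  apply: span_sum => i _; apply: spanZ; last by apply: span_mem; apply: mem_nth.
  by rewrite rpredM // rpredN rpredV.
move: c0; rewrite c00 mul0r add0r => /(is_ (fun i => c (lift ord0 i)) (fun i =>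
  cA _)) c0 i.
by case: (unliftP ord0 i) => [j ->|->]; [exact: c0|].
Qed.

Definition pow_times x (s : seq L) C : set L :=
  [set z | exists j k, [/\ (j < C)%N, k \in s & z = x ^+ j * k]].

Lemma pow_times_poly A x s C (p : {poly L}) z : p \is a polyOver (gen A) ->
  span A (pow_times x s C) z -> span A (pow_times x s (C + size p)) (p.[x] * z).
Proof.
move=> /polyOverP pA; apply: span_mull => _ [j [k [jC ks ->]]].
rewrite horner_coef mulr_suml; apply: span_sum => i _; rewrite -mulrA;
  apply: spanZ => //.
apply: span_mem; exists (i + j)%N, k; split=> //; last by rewrite mulrA exprD.
by rewrite addnC -addSn leq_add // ltnW.
Qed.

Lemma pow_times_mono x s C C' : (C <= C')%N ->
  pow_times x s C `<=` pow_times x s C'.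
Proof. by move=> CC' _ [j [k [jC ks ->]]]; exists j, k; split=> //;
  apply: leq_trans CC'. Qed.

(** The elements w with such a denominator form a subspace over A(x), and it
    contains the generators s. *)
Lemma pow_times_denom1 A x s w : span (x |` A) [set` s] w ->
  exists b C, [/\ b \is a polyOver (gen A), b.[x] != 0 &
    span A (pow_times x s C) (b.[x] * w)].
Proof.
pose M w := exists b C, [/\ b \is a polyOver (gen A), b.[x] != 0 &
    span A (pow_times x s C) (b.[x] * w)].
apply: (span_ind (M := M)); last first.
  move=> k ks; exists 1, 1%N; rewrite rpred1 hornerE oner_eq0; split=> //.
  by apply: span_mem; exists 0%N, k; rewrite expr0.
split.
- by exists 1, 0%N; rewrite rpred1 hornerE oner_eq0 mulr0; split=> //; exact: span0.
- move=> a b [p [C [pA p0 pa]]] [q [C' [qA q0 qb]]].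
  exists (p * q), (maxn (C + size q) (C' + size p)).
  split; [by rewrite rpredM|by rewrite hornerE mulf_neq0|].
  rewrite hornerM mulrDr; apply: spanD.
    rewrite -mulrA mulrCA; apply: span_mono (pow_times_poly qA pa).
    exact/pow_times_mono/leq_maxl.
  rewrite -mulrA; apply: span_mono (pow_times_poly pA qb).
  exact/pow_times_mono/leq_maxr.
- move=> c a /gen_add1[_ [_ [[p pA ->] [q qA ->] q0 ->]]] [b [C [bA b0 ba]]].
  exists (b * q), (C + size p)%N; split;
    [by rewrite rpredM|by rewrite hornerE mulf_neq0|].
  have -> : (b * q).[x] * (p.[x] / q.[x] * a) = p.[x] * (b.[x] * a).
    by rewrite hornerM; field.
  exact: pow_times_poly.
Qed.

(** dim G(N) <= r N + O(1): the filtered family G grows at most like the sections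
    of the multiples of a divisor of degree r on a curve. *)
Definition growth_le A r (G : nat -> set L) :=
  exists C, forall N, exists2 s : seq L, (size s <= N * r + C)%N &
    G N `<=` span A [set` s].

Definition low_powers x (W : seq L) N : set L :=
  [set z | exists i w, [/\ (i <= N)%N, w \in W & z = x ^+ i * w]].

Lemma pow_times_denom A x s (W : seq L) :
  (forall y, span (x |` A) [set` s] y) ->
  exists b C, [/\ b \is a polyOver (gen A), b.[x] != 0 &
    forall w, w \in W -> span A (pow_times x s C) (b.[x] * w)].
Proof.
move=> hs; elim: W => [|a W [b [C [bA b0 hb]]]].
  by exists 1, 0%N; rewrite rpred1 hornerE oner_eq0.
have [q [C' [qA q0 hq]]] := pow_times_denom1 (hs a).
exists (b * q), (maxn (C + size q) (C' + size b)).
split; [by rewrite rpredM|by rewrite hornerM mulf_neq0|].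
move=> w; rewrite inE hornerM => /predU1P[->|/hb hw].
  rewrite -mulrA; apply: span_mono (pow_times_poly bA hq).
  exact/pow_times_mono/leq_maxr.
rewrite -mulrA mulrCA; apply: span_mono (pow_times_poly qA hw).
exact/pow_times_mono/leq_maxl.
Qed.

(** In a basis of L over A(x), of size at most r, the elements of W have
    coordinates with a common denominator b(x) and numerators of bounded degree.
    So multiplying by x^i with i <= N only reaches r (N + C) products. *)
Lemma growth_transc A x r (W : seq L) :
  (forall D (u : 'I_D -> L), lin_indep (x |` A) u -> (D <= r)%N) ->
  growth_le A r (low_powers x W).
Proof.
move=> /basis_exists[s sr hs].
have [b [C [bA b0 hb]]] := pow_times_denom W hs.
exists (C * r)%N => N.
exists [seq b.[x]^-1 * (x ^+ j * k) | j <- iota 0 (N + C), k <- s].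
  by rewrite size_allpairs size_iota mulnDl leq_add // leq_mul.
move=> _ [i [w [iN wW ->]]].
have -> : x ^+ i * w = (b.[x]^-1 * x ^+ i) * (b.[x] * w) by field.
apply: span_mull (hb w wW) => _ [j [k [jC ks ->]]]; apply: span_mem => /=.
apply/allpairsP; exists ((i + j)%N, k); split=> //=.
  by rewrite mem_iota /= add0n -addnS leq_add.
by rewrite exprD !mulrA.
Qed.

Lemma alg_powers A x : alg A x ->
  exists n, forall i, span A [set z | exists2 j, (j < n)%N & z = x ^+ j] (x ^+ i).
Proof.
move=> /algP[p [p0 /polyOverP pA px]]; exists (size p).-1; elim/ltn_ind => i IH.
case: (ltnP i (size p).-1) => [lt_in|le_ni]; first by apply: span_mem; exists i.
have -> : x ^+ i = \sum_(j < (size p).-1) (- (lead_coef p)^-1 * p`_j) * x ^+ (i -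
  (size p).-1 + j).
  under eq_bigr => j _ do rewrite -mulrA exprD [p`_j * _]mulrCA.
  rewrite -!mulr_sumr; have := rootP px; rewrite horner_coef -(prednK (_ :
    0 < size p)%N) ?size_poly_gt0 //.
  rewrite big_ord_recr /= => /eqP; rewrite addr_eq0 => /eqP->.
  rewrite -lead_coefE ?mulrN ?mulNr ?opprK mulrCA mulKf ?lead_coef_eq0 //.
  by rewrite -exprD subnK.
apply: span_sum => j _; apply: spanZ;
  first by rewrite rpredM // rpredN rpredV lead_coefE.
by apply: IH; rewrite -[X in (_ < X)%N](subnK le_ni) ltn_add2l.
Qed.

Lemma growth_alg A x (W : seq L) : alg A x -> growth_le A 0 (low_powers x W).
Proof.
move=> /alg_powers[n hn]; exists (n * size W)%N => N.
exists [seq x ^+ j * k | j <- iota 0 n, k <- W];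
  first by rewrite size_allpairs size_iota muln0.
move=> _ [i [w [iN wW ->]]]; rewrite mulrC; apply: span_mull (hn i) => _ [j jn ->].
by apply: span_mem; apply/allpairsP; exists (j, w); split;
  rewrite ?mem_iota // mulrC.
Qed.

Lemma growth_const A (W : seq L) : growth_le A 0 (fun=> [set` W]).
Proof. by exists (size W) => N; exists W; rewrite ?muln0 // => w ww;
  apply: span_mem. Qed.

Lemma growthD A r r' G G' : growth_le A r G -> growth_le A r' G' ->
  growth_le A (r + r') (fun N => G N `|` G' N).
Proof.
move=> [C hC] [C' hC']; exists (C + C')%N => N.
have [s hs Gs] := hC N; have [s' hs' Gs'] := hC' N.
exists (s ++ s'); first by rewrite size_cat mulnDr addnACA leq_add.
by move=> z [/Gs|/Gs']; apply: span_mono => w /= ws; rewrite mem_cat ws ?orbT.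
Qed.

Lemma growth_sub A r G G' : (forall N, G N `<=` span A (G' N)) ->
  growth_le A r G' -> growth_le A r G.
Proof.
move=> GG' [C hC]; exists C => N; have [s hs Gs] := hC N; exists s => // z /GG'.
exact: span_sub.
Qed.

(** Comparing D (N + 1) independent elements with a space of dimension r N + C for
    large N. *)
Lemma growth_lin_indep A r G D (u : nat -> 'I_D -> nat -> L) : growth_le A r G ->
  (forall N, lin_indep A (fun k : 'I_D * 'I_N.+1 => u N k.1 k.2)) ->
  (forall N i b, (b <= N)%N -> span A (G N) (u N i b)) -> (D <= r)%N.
Proof.
move=> [C hC] iu uG; rewrite leqNgt; apply/negP => rD.
have [s hs Gs] := hC C.
have : (D * C.+1 <= size s)%N.
  have := lin_indep_span_le (iu C) (s := s); rewrite card_prod !card_ord;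
    apply=> -[i b] /=.
  by apply: span_sub (uG C i b _); [exact: Gs|rewrite -ltnS].
rewrite leqNgt; apply/negP; rewrite negbK; apply: leq_ltn_trans hs _.
apply: (leq_trans _ (_ : r.+1 * C.+1 <= _)%N); last by rewrite leq_mul2r rD orbT.
by rewrite mulSn mulnS mulnC; lia.
Qed.
End Span.

(** * Degree of a multilinear function on a curve *)

Section Boxes.
Local Open Scope classical_set_scope.
Local Open Scope ring_scope.
Variable L : fieldType.
Implicit Types (A B M W : set L) (x y : L).

Fixpoint box_monomials n (xs : seq L) : set L :=
  if xs is x :: xs' then
    [set z | exists i m, [/\ (i <= n)%N, box_monomials n xs' m & z = x ^+ i * m]]
  else [set 1].

Lemma box_monomials1 n xs : box_monomials n xs 1.
Proof. by elim: xs => //= x xs IH; exists 0%N, 1; rewrite expr0 mulr1. Qed.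

Lemma box_monomialsM m n xs a b : box_monomials m xs a -> box_monomials n xs b ->
  box_monomials (m + n) xs (a * b).
Proof.
elim: xs a b => [|x xs IH] a b /=; first by move=> -> ->; rewrite mulr1.
move=> [i [a' [im ha ->]]] [j [b' [jn hb ->]]].
exists (i + j)%N, (a' * b'); split; [exact: leq_add|exact: IH|].
by rewrite exprD mulrACA.
Qed.

Lemma span_box_monomialsM A m n xs a b : span A (box_monomials m xs) a ->
  span A (box_monomials n xs) b ->
  span A (box_monomials (m + n) xs) (a * b).
Proof. by apply: span_mul => v w hv hw; apply: span_mem; apply: box_monomialsM. Qed.

Lemma span_box_monomialsX A n xs a : span A (box_monomials 1 xs) a ->
  span A (box_monomials n xs) (a ^+ n).
Proof.
move=> ha; elim: n => [|n IH]; first by apply: span_mem; exact: box_monomials1.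
by rewrite exprS; apply: (span_box_monomialsM (m := 1)).
Qed.

(** The coordinate change t = 1 / (x - c) in each variable turns multilinear
    forms in the x into multilinear forms in the t, up to the common factor
    z, the product of the t. *)
Lemma box_monomials_shift A (V : Type) (S : seq V) (x c : V ->
  L) (t := fun v => (x v - c v)^-1) :
  (forall v, c v \in gen A) -> (forall v, x v != c v) ->
  exists2 z, z != 0 & forall g, span A (box_monomials 1 (map x S)) g ->
    span A (box_monomials 1 (map t S)) (z * g).
Proof.
move=> cA xc; elim: S => [|v S [z z0 hz]] /=.
  by exists 1; rewrite ?oner_eq0 // => g; rewrite mul1r.
have t0 : t v != 0 by rewrite invr_eq0 subr_eq0.
exists (t v * z); rewrite ?mulf_neq0 // => g; apply: span_mull =>
  _ [i [m [i1 hm ->]]].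
have {}hm := hz m (span_mem hm).
have hj j : (j <= 1)%N -> span A (box_monomials 1 (t v :: map t S)) (t v ^+ j *
  (z * m)).
  by move=> j1; apply: span_mull hm => w hw; apply: span_mem => /=; exists j, w.
case: i i1 => [|[|//]] _.
  by have := hj 1%N isT; rewrite expr0 mul1r expr1 mulrA.
have -> : t v * z * (x v ^+ 1 * m) = t v ^+ 0 * (z * m) + c v * (t v ^+ 1 * (z *
  m)).
  by rewrite /t in t0 *; field; move: t0; rewrite invr_eq0.
by apply: spanD; [exact: hj|apply: spanZ => //; exact: hj].
Qed.

Definition corner_rect_monomials (s t : L) q p : set L :=
  [set z | exists i j, [/\ (i <= q)%N, (j <= p)%N, (i < q)%N || (j < p)%N & z =
    s ^+ i * t ^+ j]].

(** The corner monomial of the rectangle reduces to the other monomials. *)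
Definition corner A s t q p := span A (corner_rect_monomials s t q p) (s ^+ q *
  t ^+ p).

Lemma corner_mono A s t q p q' p' : (q <= q')%N -> (p <= p')%N ->
  corner A s t q p -> corner A s t q' p'.
Proof.
move=> qq pp; rewrite /corner.
have -> : s ^+ q' * t ^+ p' = (s ^+ (q' - q) * t ^+ (p' - p)) * (s ^+ q * t ^+ p).
  by rewrite mulrACA -!exprD !subnK.
apply: span_mull => _ [i [j [iq jp ij ->]]]; apply: span_mem.
exists (q' - q + i)%N, (p' - p + j)%N; split; [lia|lia|lia|].
by rewrite mulrACA -!exprD.
Qed.

(** Let P(s, x) = 0 with leading coefficient l(x) in s.  In the coordinate
    t = 1 / (x - c), the coefficient of the corner monomial of the transformed
    relation is l(c), because multiplying by the maximal power of t reverses the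
    Taylor expansion at c. *)
Lemma alg_dependent_corner A s x : alg_dependent A s x ->
  exists l Q, [/\ l != 0 & forall c, c \in gen A -> l.[c] != 0 -> x != c ->
    corner A s (x - c)^-1 Q Q].
Proof.
move=> [P [P0 /polyOverP PA Psx]].
(* q is the degree of P in s; p is a strict bound on its degree in x. *)
pose q := (size P).-1; pose p := sizeY P.
exists (lead_coef P), (maxn q p); split; first by rewrite lead_coef_eq0.
move=> c cA lc xc; set t := (x - c)^-1.
apply: (@corner_mono _ _ _ q p); [exact: leq_maxl|exact: leq_maxr|].
pose a i k := (P`_i \Po ('X + c%:P))`_k.
have aA i k : a i k \in gen A.
  have cP : 'X + c%:P \is a polyOver (gen A) by rewrite rpredD ?polyOverX ?polyOverC.
  have /polyOverP h := polyOver_comp (PA i) cP; exact: h.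
have xc0 : x - c != 0 by rewrite subr_eq0.
(* Taylor expansion at c, multiplied by t^p. *)
have Pt i : t ^+ p * (P`_i).[x] = \sum_(k < p.+1) a i k * t ^+ (p - k).
  have -> : (P`_i).[x] = (P`_i \Po ('X + c%:P)).[x - c].
    by rewrite horner_comp !hornerE subrK.
  rewrite (@horner_coef_wide _ p.+1); last first.
    rewrite size_comp_poly2 ?size_XaddC //; apply: leqW; exact: max_size_coefXY.
  rewrite mulr_sumr; apply: eq_bigr => k _; rewrite mulrCA; congr (_ * _).
  have kp : (k <= p)%N by rewrite -ltnS.
  by rewrite -{1}(subnK kp) exprD -mulrA -exprMn mulVf // expr1n mulr1.
have a0 : a q 0%N = (lead_coef P).[c].
  by rewrite /a -horner_coef0 horner_comp !hornerE lead_coefE.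
have sumP : \sum_(i < q) s ^+ i * (t ^+ p * (P`_i).[x]) + s ^+ q * (t ^+ p *
  (P`_q).[x]) = 0.
  have := Psx; rewrite horner2E (@horner_coef_wide _ (size P));
    last exact: size_poly.
  have -> : size P = q.+1 by rewrite /q prednK ?size_poly_gt0.
  move=> /(congr1 (fun z => t ^+ p * z));
    rewrite mulr0 mulr_sumr big_ord_recr /= => h; rewrite -[RHS]h.
  congr (_ + _); last by rewrite coef_map /= horner_evalE; ring.
  by apply: eq_bigr => i _; rewrite coef_map /= horner_evalE; ring.
rewrite (Pt q) big_ord_recl subn0 a0 in sumP.
rewrite /corner.
have -> : s ^+ q * t ^+ p = - (lead_coef P).[c]^-1 *
    (\sum_(i < q) s ^+ i * (t ^+ p * (P`_i).[x]) +
     s ^+ q * \sum_(i < p) a q (lift ord0 i) * t ^+ (p - lift ord0 i)).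
  set X := \sum_(i < q) _ in sumP *; set Y := \sum_(i < p) _ in sumP *.
  have -> : X + s ^+ q * Y = - (s ^+ q * (lead_coef P).[c] * t ^+ p).
    by apply/eqP; rewrite -addr_eq0; apply/eqP; rewrite -[RHS]sumP; ring.
  by field.
apply: spanZ; first by rewrite rpredN rpredV -a0.
apply: spanD.
  apply: span_sum => i _; rewrite Pt mulr_sumr; apply: span_sum => k _.
  rewrite mulrCA; apply: spanZ => //; apply: span_mem; exists i, (p - k)%N.
  by split => //; [exact: ltnW|exact: leq_subr|rewrite ltn_ord].
rewrite mulr_sumr; apply: span_sum => k _; rewrite mulrCA; apply: spanZ => //.
apply: span_mem; exists q, (p - lift ord0 k)%N; split=> //; first exact: leq_subr.
by apply/orP; right; rewrite /= /bump /=; have := ltn_ord k; lia.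
Qed.

Hypothesis char0 : injective (fun n : nat => n%:R : L).

Lemma nat_nonroot (p : {poly L}) : p != 0 ->
  exists2 n : nat, (n < size p)%N & p.[n%:R] != 0.
Proof.
move=> p0; apply: contrapT => h.
suff: (size [seq n%:R : L | n <- iota 0 (size p)] < size p)%N.
  by rewrite size_map size_iota ltnn.
apply: max_poly_roots => //; last by rewrite map_inj_uniq ?iota_uniq.
apply/allP => y /mapP[n]; rewrite mem_iota /= => np ->.
by apply: contra_notT h => pn; exists n.
Qed.

(** Each of finitely many relations excludes finitely many values of c, while the
    subfield is infinite. *)
Lemma corner_exists A (ss : seq L) x : (forall s, s \in ss ->
  alg_dependent A s x) ->
  exists c Q, [/\ c \in gen A, x != c & forall s, s \in ss ->
    corner A s (x - c)^-1 Q Q].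
Proof.
move=> hb.
suff [l [Q [l0 hl]]] : exists l Q, [/\ l != 0 & forall c, c \in gen A ->
  l.[c] != 0 -> x != c ->
    forall s, s \in ss -> corner A s (x - c)^-1 Q Q].
  have [] := @nat_nonroot (l * ('X - x%:P));
    first by rewrite mulf_neq0 // polyXsubC_eq0.
  move=> n _; rewrite !hornerE mulf_eq0 negb_or subr_eq0 => /andP[ln nx].
  by exists n%:R, Q; rewrite rpred_nat eq_sym nx; split => //; apply: hl;
    rewrite ?rpred_nat // eq_sym.
elim: ss hb => [|s ss IH] hb; first by exists 1, 0%N; rewrite oner_eq0.
have [l [Q [l0 hl]]] := IH (fun s' hs => hb s' (mem_behead (s := s :: ss) hs)).
have [k [Q' [k0 hk]]] := alg_dependent_corner (hb s (mem_head _ _)).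
exists (l * k), (maxn Q Q'); split; first by rewrite mulf_neq0.
move=> c cA; rewrite hornerM mulf_eq0 negb_or => /andP[lc kc] xc s'.
rewrite inE => /predU1P[->|s's].
  by apply: corner_mono (hk c cA kc xc); exact: leq_maxr.
by apply: corner_mono (hl c cA lc xc s' s's); exact: leq_maxl.
Qed.

(** Monomials with both exponents at least Q are rewritten until none is left;
    each step lowers the total degree and stays inside the square of side N. *)
Lemma corner_rect A s t Q N i j : corner A s t Q Q -> (i <= N)%N -> (j <= N)%N ->
  span A [set z | exists i j, [/\ (i <= N)%N, (j <= N)%N,
    (i < Q)%N || (j < Q)%N & z = s ^+ i * t ^+ j]]
    (s ^+ i * t ^+ j).
Proof.
move=> hc; move: {2}(i + j)%N (erefl (i + j)%N) => n.
elim/ltn_ind: n i j => n IH i j ijn iN jN.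
case: (boolP ((i < Q) || (j < Q))%N) => [ijQ|]; first by apply: span_mem;
  exists i, j.
rewrite negb_or -!leqNgt => /andP[Qi Qj].
have -> : s ^+ i * t ^+ j = (s ^+ (i - Q) * t ^+ (j - Q)) * (s ^+ Q * t ^+ Q).
  by rewrite mulrACA -!exprD !subnK.
apply: span_mull hc => _ [i' [j' [i'Q j'Q ij' ->]]].
rewrite mulrACA -!exprD; apply: (IH (i - Q + i' + (j - Q + j'))%N) => //; lia.
Qed.

Definition low_box (V : eqType) (S : seq V) (t : V -> L) (W : seq L) N : set L :=
  [set` W] `|` [set z | exists2 v, v \in S & low_powers (t v) W N z].

(** On a curve any two functions are dependent, so in suitable coordinates every
    monomial reduces to monomials in which only one exponent is large.  This is
    why the degrees of the variables add up instead of multiplying.  The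
    coordinates are chosen one at a time: the new one must have a usable corner
    with respect to each of the earlier ones. *)
Lemma box_reduction A (V : eqType) (S : seq V) (x : V -> L) :
  uniq S -> (forall a b, alg_dependent A a b) ->
  exists c : V -> L, [/\ (forall v, c v \in gen A), (forall v, x v != c v) &
    exists W : seq L, forall N, box_monomials N [seq (x v - c v)^-1 | v <- S] `<=`
       span A (low_box S (fun v => (x v - c v)^-1) W N)].
Proof.
move=> + hb; elim: S => [_|v S IH] /=.
  have /choice[c hc] : forall v, exists c, c \in gen A /\ x v != c.
    move=> v; have [] // := @corner_exists A [::] (x v) => c [Q [cA xc _]].
    by exists c.
  exists c; split=> [v|v|]; [exact: (hc v).1|exact: (hc v).2|].
  by exists [:: 1] => N _ ->; apply: span_mem; left; rewrite /= mem_head.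
move=> /andP[vS /IH[c [cA xc [W hW]]]].
have [d [Q [dA xd hd]]] := @corner_exists A [seq (x v -
  c v)^-1 | v <- S] (x v) (fun s _ => hb s _).
exists (fun u => if u == v then d else c u); split=> [u|u|].
- by case: ifP.
- by case: (eqVneq u v) => [->|].
set t := (x v - d)^-1.
(* One small exponent, in t or in an earlier coordinate, is absorbed into W. *)
pose W1 := [seq t ^+ i * w | i <- iota 0 Q, w <- W].
pose W2 := flatten [seq [seq (x u - c u)^-1 ^+ i * w | i <- iota 0 Q,
  w <- W] | u <- S].
exists (W ++ W1 ++ W2) => N.
have tS u : u \in S -> (x u - (if u == v then d else c u))^-1 = (x u - c u)^-1.
  by case: eqP => // ->; rewrite (negPf vS).
have -> : [seq (x u - (if u == v then d else c u))^-1 | u <- S] = [seq (x u -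
  c u)^-1 | u <- S].
  by apply/eq_in_map => u uS; rewrite /= tS.
rewrite eqxx -/t.
move=> _ /= [i [m [iN /hW hm ->]]]; apply: span_mull hm => z [/= zW|[u uS]].
  apply: span_mem; right; exists v; first exact: mem_head.
  by exists i, z; rewrite eqxx mem_cat zW.
case=> [j [w [jN wW ->]]]; set s := (x u - c u)^-1 in hd *.
have := corner_rect (hd s (map_f _ uS)) jN iN; rewrite -/t => hr.
have -> : t ^+ i * (s ^+ j * w) = w * (s ^+ j * t ^+ i) by ring.
apply: span_mull hr => _ [j' [i' [jN' iN' /orP[jQ|iQ] ->]]]; apply: span_mem; right.
  exists v; first exact: mem_head.
  exists i', (s ^+ j' * w); split=> //; last by rewrite eqxx -/t; ring.
  rewrite !mem_cat; apply/orP; right; apply/orP; right; apply/flattenP.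
  exists [seq s ^+ i * w | i <- iota 0 Q, w <- W].
    by apply/mapP; exists u.
  by apply/allpairsP; exists (j', w); rewrite mem_iota.
exists u; first by rewrite inE uS orbT.
exists j', (t ^+ i' * w); split=> //; last by rewrite tS // -/s; ring.
rewrite !mem_cat; apply/orP; right; apply/orP; left.
by apply/allpairsP; exists (i', w); rewrite mem_iota.
Qed.

Lemma growth_low_box A (V : eqType) (S : seq V) (t : V ->
  L) (W : seq L) (r : V -> nat) :
  (forall v, v \in S -> growth_le A (r v) (low_powers (t v) W)) ->
  growth_le A (\sum_(v <- S) r v) (low_box S t W).
Proof.
elim: S => [|v S IH] h.
  rewrite big_nil; apply: growth_sub (growth_const A W) => N z [zW|[]//].
  exact: span_mem.
rewrite big_cons; apply: growth_sub (growthD (h v (mem_head _ _)) (IH _)).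
  move=> N z [zW|[u]]; first by apply: span_mem; right; left.
  rewrite inE => /predU1P[->|uS] hz; apply: span_mem; first by left.
  by right; right; exists u.
by move=> u uS; apply: h; rewrite inE uS orbT.
Qed.

Lemma growth_le_mono A r r' (G : nat -> set L) : (r <= r')%N ->
  growth_le A r G -> growth_le A r' G.
Proof.
move=> rr [C hC]; exists C => N; have [s hs Gs] := hC N; exists s => //.
by apply: leq_trans hs _; rewrite leq_add2r leq_mul.
Qed.

Lemma lin_indep_mono A B (I : finType) (u : I -> L) :
  {subset gen A <= gen B} -> lin_indep B u -> lin_indep A u.
Proof. by move=> AB iu c cA; apply: iu => i; apply/AB/cA. Qed.

(** The curve case: when L has transcendence degree one over the field of A, a
    quotient g / h of multilinear forms in the x_v has degree at most the sum of
    the degrees of the x_v.  The products of u_i with g^b h^(N - b) are D (N + 1)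
    independent elements, while they lie in a space of dimension at most
    N times the sum of the r_v, up to a constant. *)
Lemma degree_multilinear A (V : eqType) (S : seq V) (x : V ->
  L) (g h : L) r D (u : 'I_D -> L) :
  uniq S -> (forall a b, alg_dependent A a b) ->
  span A (box_monomials 1 (map x S)) g -> span A (box_monomials 1 (map x S)) h ->
    h != 0 ->
  ~ alg A (g / h) -> lin_indep (g / h |` A) u ->
  (forall v, v \in S -> ~ alg A (x v) ->
     forall D' (u' : 'I_D' -> L), lin_indep (x v |` A) u' -> (D' <= r v)%N) ->
  (D <= \sum_(v <- S) r v)%N.
Proof.
move=> uS hb hg hh h0 yA iu hr.
have [c [cA xc [W hW]]] := box_reduction x uS hb.
have [z z0 hz] := box_monomials_shift S cA xc.
pose t v := (x v - c v)^-1.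
(* The multipliers u_i are absorbed into W, without effect on the growth. *)
pose W' := [seq u i * w | i <- enum 'I_D, w <- W].
have xt v : x v - c v != 0 by rewrite subr_eq0.
have gr : growth_le A (\sum_(v <- S) r v) (low_box S t W').
  apply: growth_low_box => v vS; have [xA|xA] := pselect (alg A (x v)).
    apply: (growth_le_mono (leq0n _)); apply: growth_alg.
    have [_ sB sD] := alg_subfield A; rewrite /t -[_^-1]mul1r.
    by apply: sD; [exact/gen_alg/rpred1|apply: sB => //; exact: gen_alg].
  apply: growth_transc => D' u' iu'; apply: hr xA _ _ _ => //.
  apply: lin_indep_mono iu'; apply: gen_sub => w [->|wA]; last by apply: mem_gen;
    right.
  have -> : x v = c v + (t v)^-1 by rewrite /t invrK addrC subrK.
  apply: rpredD; first by apply: gen_mono (cA v) => w'; right.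
  by apply: GRing.rpredVr; apply: mem_gen; left.
apply: (growth_lin_indep (u := fun N i b => u i * ((z * g) ^+ b * (z * h) ^+ (N -
  b))) gr).
  move=> N k kA k0; apply: (lin_indep_powers yA iu kA).
  have zh0 : (z * h) ^+ N != 0 by rewrite expf_neq0 // mulf_neq0.
  apply: (mulfI zh0); rewrite mulr0 -[RHS]k0 mulr_sumr;
    apply: eq_bigr => -[i b] _ /=.
  have bN : (b <= N)%N by rewrite -ltnS.
  have -> : (z * g) ^+ b * (z * h) ^+ (N - b) = (z * h) ^+ N * (g / h) ^+ b.
    have -> : z * g = z * h * (g / h) by field.
    by rewrite exprMn mulrAC -exprD subnKC.
  by ring.
move=> N i b bN.
have : span A (box_monomials N [seq t v | v <- S]) ((z * g) ^+ b * (z *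
  h) ^+ (N - b)).
  by rewrite -(subnKC bN) addKn; apply: span_box_monomialsM;
    apply: span_box_monomialsX; apply: hz.
move/(span_sub (@hW N)); apply: span_mull => w [wW|[v vS [j [w' [jN wW ->]]]]];
  apply: span_mem.
  by left; apply/allpairsP; exists (i, w); rewrite mem_enum.
right; exists v => //; exists j, (u i * w'); split=> //; last by rewrite mulrCA.
by apply/allpairsP; exists (i, w'); rewrite mem_enum.
Qed.

End Boxes.

(** * Matchings and the degree of a system of multilinear equations *)

Section Induction.
Local Open Scope classical_set_scope.
Local Open Scope ring_scope.
Variable L : fieldType.
Implicit Types (A B F K M W : set L) (y z : L).

(** If L is algebraic over A(z), any two of its elements are dependent over A. *)
Lemma alg_dependent_all A z : (forall y, alg (z |` A) y) ->
  forall a b, alg_dependent A a b.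
Proof.
move=> hz a b; have [aA|aA] := pselect (alg A a).
  by apply: alg_alg_dependent; apply: alg_mono aA => w; right.
apply: alg_dependent_sym; apply: alg_alg_dependent;
  apply: alg_trans (hz b) => w [->|wA].
  exact: alg_exchange.
by apply/gen_alg/mem_gen; right.
Qed.

Lemma span_coef A B W : {subset gen A <= gen B} -> span A W `<=` span B W.
Proof.
move=> AB; have [h0 hD hZ] := span_subspace B W.
move=> y; apply: span_ind; last exact: span_mem.
by split=> // c z /AB; exact: hZ.
Qed.

Lemma box_monomials_filter A (V : Type) (P : pred V) (x : V -> L) (S : seq V) :
  (forall v, ~~ P v -> x v \in gen A) ->
  box_monomials 1 (map x S) `<=` span A (box_monomials 1 (map x (filter P S))).
Proof.
move=> xA; elim: S => [|v S IH] /=; first exact: span_mem.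
move=> _ [i [m [i1 /IH hm ->]]]; case: ifPn => [_|/xA xvA].
  by apply: span_mull hm => w hw; apply: span_mem; exists i, w.
by apply: spanZ => //; rewrite rpredX.
Qed.

Variables (V E : finType) (adj : E -> seq V) (x : V -> L) (lam : E -> L).

(** The systems of distinct representatives of es in A, built one edge at a
    time; the recursion is the expansion of a permanent along a row. *)
Fixpoint matchings (es : seq E) (A : {set V}) : seq (seq V) :=
  if es is e :: es' then
    [seq v :: s | v <- [seq v <- adj e | v \in A],
      s <- matchings es' (finset.setD A (finset.set1 v))]
  else [:: [::]].

Definition lam_values (es : seq E) : set L := [set y | exists2 e, e \in es & y =
  lam e].

Fixpoint alg_indep K (es : seq E) : Prop :=
  if es is e :: es' then ~ alg (lam_values es' `|` K) (lam e) /\ alg_indep K es' else True.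

Lemma lam_values_cons e es K : lam_values (e :: es) `|` K =
  lam e |` (lam_values es `|` K).
Proof.
apply/predeqP => y; split=> [[[f]|yK]|[->|[[f fes ->]|yK]]].
- by rewrite inE => /predU1P[-> ->|fes ->]; [left|right; left; exists f].
- by right; right.
- by left; exists e; rewrite ?mem_head.
- by left; exists f; rewrite // inE fes orbT.
- by right.
Qed.

(** Independence of a family over K and of z over the family with K is symmetric
    in the two, by exchange. *)
Lemma alg_indep_adjoin K es z :
  alg_indep K es -> ~ alg (lam_values es `|` K) z -> alg_indep (z |` K) es.
Proof.
elim: es => //= e es IH [he hes]; rewrite lam_values_cons => hz; split; last first.
  by apply: IH => // hz'; apply: hz; apply: alg_mono hz' => w; right.
by rewrite setUCA => h; apply: hz; apply: alg_exchange h he.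
Qed.

Definition x_values (S : seq V) : set L := [set y | exists2 v, v \in S & y = x v].

Lemma exchange_x_values F (S : seq V) y : alg (x_values S `|` F) y -> ~ alg F y ->
  exists2 v, v \in S & alg (y |` (x_values (rem v S) `|` F)) (x v).
Proof.
move=> + yF; elim: S => [|w S IH] hy.
  by case: yF; apply: alg_mono hy => z [[]|].
have [hS|hS] := pselect (alg (x_values S `|` F) y).
  have [v vS hv] := IH hS; exists v; first by rewrite inE vS orbT.
  apply: alg_mono hv => z [->|[[u uS ->]|zF]]; [by left|right; left|by right;
    right].
  by exists u => //=; case: eqP => _; [exact: mem_rem uS|rewrite inE uS orbT].
exists w; first exact: mem_head.
rewrite /= eqxx; apply: alg_exchange hS.
apply: alg_mono hy => z [[u]|zF]; last by right; right.
by rewrite inE => /predU1P[-> ->|uS ->]; [left|right; left; exists u].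
Qed.

(** Steinitz exchange: every independent element replaces one of the generators. *)
Lemma steinitz K es (S : seq V) : alg_indep K es ->
  (forall y, alg (x_values S `|` K) y) ->
  exists2 S', (size S' + size es = size S)%N &
    forall y, alg (x_values S' `|` (lam_values es `|` K)) y.
Proof.
move=> + hS; elim: es => [_|e es IH /= [he /IH[S' sS' hS']]].
  exists S; rewrite ?addn0 // => y; apply: alg_mono (hS y) => z [|]; first by left.
  by right; right.
have [v vS' hv] := exchange_x_values (hS' (lam e)) he.
exists (rem v S').
  rewrite size_rem // -sS'; case: (S') vS' => //= a s _; lia.
move=> y; rewrite lam_values_cons setUCA; apply: alg_trans (hS' y) =>
  z [[w wS' ->]|zF]; last first.
  by apply/gen_alg/mem_gen; right; right.
have [->//|wv] := eqVneq w v.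
apply/gen_alg/mem_gen; right; left; exists w => //.
by have := perm_mem (perm_to_rem vS') w; rewrite wS' inE (negPf wv).
Qed.

Hypothesis char0 : injective (fun n : nat => n%:R : L).
Variable K0 : set L.
Hypothesis adj_uniq : forall e, uniq (adj e).
Hypothesis lamE : forall e, exists g h,
  [/\ span K0 (box_monomials 1 (map x (adj e))) g,
  span K0 (box_monomials 1 (map x (adj e))) h, h != 0 & lam e = g / h].

(** Removing the equation e leaves a curve over F = K(lam_es), on which
    [degree_multilinear] bounds D by the sum of the degrees [L : F(x_v)] over the
    v in e with x_v transcendental over F.  Adjoining x_v to K makes [L : F(x_v)] the degree of the smaller system in
    the remaining variables, to which induction applies. *)
Lemma degree_matchings es (A : {set V}) K D (u : 'I_D -> L) :
  K0 `<=` K -> (forall v, v \notin A -> x v \in gen K) ->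
  (forall y, y \in gen (range x `|` K)) -> #|A| = size es ->
  alg_indep K es -> (forall y, alg (lam_values es `|` K) y) ->
  lin_indep (lam_values es `|` K) u -> (D <= size (matchings es A))%N.
Proof.
elim: es A K D u => [|e es IH] A K D u K0K xK hK cA.
  move=> _ _ iu; rewrite /= in cA *; rewrite -[D]card_ord.
  apply: (lin_indep_span_le (s := [:: 1]) iu) => i; rewrite -[u i]mulr1.
  apply: spanZ; last by apply: span_mem; rewrite /= mem_head.
  apply: gen_sub (hK (u i)) => y [[v _ <-]|yK]; last by apply: mem_gen; right.
  have : x v \in gen K by apply: xK; move/eqP: cA; rewrite cards_eq0 => /eqP->;
    rewrite inE.
  by apply: gen_mono => w; right.
move=> /= [he hes]; rewrite lam_values_cons; set F := lam_values es `|` K =>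
  halg iu.
rewrite size_allpairs_dep sumnE big_map.
have KF : {subset gen K <= gen F} by apply: gen_mono => w; right.
have [g [h [hg hh h0 lE]]] := lamE e.
have toF w : span K0 (box_monomials 1 (map x (adj e))) w ->
    span F (box_monomials 1 (map x [seq v <- adj e | v \in A])) w.
  move=> hw; have {}hw : span F (box_monomials 1 (map x (adj e))) w.
    by apply: span_coef hw => c cK0; apply: KF; apply: gen_mono cK0.
  by apply: span_sub hw; apply: box_monomials_filter => v /xK/KF.
rewrite lE in he iu halg.
apply: (degree_multilinear char0 _ (alg_dependent_all halg) (toF g hg) (toF h hh) h0 he iu).
  exact: filter_uniq.
move=> v; rewrite mem_filter => /andP[vA _] xvF D' u' iu'.
have FE : lam_values es `|` (x v |` K) = x v |` F by rewrite setUCA.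
apply: (IH _ (x v |` K) _ u').
- by move=> w /K0K; right.
- move=> w; rewrite finset.in_setD1 negb_and negbK => /orP[/eqP->|/xK];
    first by apply: mem_gen; left.
  by apply: gen_mono => z; right.
- by move=> y; apply: gen_mono (hK y) => z [|]; [left|right; right].
- by apply: succn_inj; rewrite -[RHS]cA (cardsD1 v A) vA.
- exact: alg_indep_adjoin.
- move=> y; rewrite FE; apply: alg_trans (halg y) => z [->|zF].
    by apply: alg_exchange xvF; apply: halg.
  by apply/gen_alg/mem_gen; right.
- by rewrite FE.
Qed.

Theorem degree_le_matchings es (A : {set V}) D (u : 'I_D -> L) :
  (forall v, v \notin A -> x v \in gen K0) ->
  (forall y, y \in gen (range x `|` K0)) -> #|A| = size es ->
  alg_indep K0 es -> lin_indep (lam_values es `|` K0) u ->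
    (D <= size (matchings es A))%N.
Proof.
move=> xK hK cA hes; apply: (@degree_matchings es A K0 D u) => // y.
have [z|S' sS' hS'] := @steinitz K0 es (enum A) hes.
  apply: gen_alg; apply: gen_sub (hK z) => w [[v _ <-]|wK];
    last by apply: mem_gen; right.
  have [vA|/xK] := boolP (v \in A); last by apply: gen_mono => ?; right.
  by apply: mem_gen; left; exists v; rewrite ?mem_enum.
have S'0 : S' = [::].
  by apply/nilP; rewrite /nilp -(eqn_add2r (size es)) sS' -cA cardE.
by apply: alg_mono (hS' y) => z [[v]|//]; rewrite S'0.
Qed.

End Induction.

(** * Counting perfect matchings *)

Section Matchings.
Variables (V E : finType) (adj : E -> seq V) (e0 : E) (v0 : V).
Hypothesis adj_uniq : forall e, uniq (adj e).

Lemma matchings_uniq es (A : {set V}) : uniq (matchings adj es A).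
Proof.
elim: es A => //= e es IH A; apply: allpairs_uniq_dep.
- by rewrite filter_uniq.
- by move=> v _; exact: IH.
- by move=> [v s] [w t] _ _ /= [-> ->].
Qed.

Lemma matchingsP es (A : {set V}) s : s \in matchings adj es A ->
  [/\ size s = size es, uniq s, {subset s <= A} &
      forall i, i < size es -> nth v0 s i \in adj (nth e0 es i)].
Proof.
elim: es A s => [|e es IH] A s /=; first by rewrite inE => /eqP->.
case/allpairsPdep => v [t [+ /IH[<- ut tA ht] ->]] /=;
  rewrite mem_filter => /andP[vA ve].
split=> //.
- by rewrite ut andbT; apply/negP => /tA; rewrite !inE eqxx.
- by move=> w; rewrite inE => /predU1P[->//|/tA]; rewrite !inE => /andP[].
- by move=> [|i] //=; exact: ht.
Qed.

(** A system of representatives s lists the vertex matched to each edge; the vertex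
    a is sent back to the edge having its position in s. *)
Lemma matchings_le_perfect (S : {set V}) (G : bigraph V E) :
  (forall e v, v \in adj e -> G v e) -> #|~: S| = #|E| ->
  size (matchings adj (enum E) (~: S)) <= num_perfect_matchings (delete_left G S).
Proof.
move=> adjG cS.
pose f (s : seq V) := [ffun a : {a : V | a \notin S} =>
  nth e0 (enum E) (index (val a) s)].
have hs s : s \in matchings adj (enum E) (~: S) ->
    [/\ size s = #|E|, uniq s, s =i ~: S & forall i, i < #|E| ->
      nth v0 s i \in adj (nth e0 (enum E) i)].
  move=> /matchingsP; rewrite -cardE => -[sz us sS hi]; split=> //.
  have := uniq_min_size us (s2 := enum (~: S)); case.
  - by move=> v; rewrite mem_enum; exact: sS.
  - by rewrite -cardE cS sz.
  - by move=> _ h v; rewrite h mem_enum.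
have hidx s (a : {a : V | a \notin S}) : s \in matchings adj (enum E) (~: S) ->
  index (val a) s < #|E|.
  by move=> /hs[<- _ hS _]; rewrite index_mem hS inE; exact: (valP a).
rewrite /num_perfect_matchings cardE -(size_map f).
apply: uniq_leq_size.
  rewrite map_inj_in_uniq ?matchings_uniq // => s t sM tM /ffunP st.
  have [szs us sS _] := hs s sM; have [szt ut tS _] := hs t tM.
  have idx v : v \notin S -> index v s = index v t.
    move=> vS; have := st (Sub v vS); rewrite !ffunE => /eqP.
    have := hidx s (Sub v vS) sM; have := hidx t (Sub v vS) tM;
      rewrite SubK => ht hs'.
    by rewrite nth_uniq ?enum_uniq -?cardE // => /eqP.
  apply: (@eq_from_nth _ v0); first by rewrite szs szt.
  move=> i lt_is; have vS : nth v0 s i \notin S.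
    by have := mem_nth v0 lt_is; rewrite sS inE.
  have := idx _ vS; rewrite index_uniq // => h; rewrite [in RHS]h nth_index //.
  by rewrite tS inE.
move=> _ /mapP[s sM ->]; rewrite mem_enum inE; have [szs us sS hi] := hs s sM.
have finj : injective (f s).
  move=> a b; rewrite !ffunE => /eqP;
    rewrite nth_uniq ?enum_uniq -?cardE ?hidx // => /eqP ab.
  apply: val_inj; rewrite -[LHS](nth_index v0 (s := s)); last by rewrite sS inE;
    exact: (valP a).
  by rewrite ab nth_index // sS inE; exact: (valP b).
apply/and3P; split; first exact/injectiveP.
  apply/forallP => b; apply: (inj_card_onto finj).
  by rewrite card_sig -cS; apply/eq_leq/eq_card => v; rewrite !inE.
apply/forallP => a; rewrite /delete_left; apply: adjG; rewrite ffunE.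
have aS : val a \in s by rewrite sS inE; exact: (valP a).
by have := hi _ (hidx s a sM); rewrite nth_index.
Qed.
End Matchings.

(** * Moebius transformations and normalized configurations *)

Section Moebius.
Local Open Scope classical_set_scope.
Local Open Scope ring_scope.
Variable K : fieldType.
Implicit Types (p q : P1 K) (v w : K * K).

Definition homogeneous p : K * K := if p is Some z then (z, 1) else (1, 0).
Definition point_of v : P1 K := if v.2 == 0 then None else Some (v.1 / v.2).
Definition bracket v w := v.1 * w.2 - w.1 * v.2.
(** A Moebius map is a linear map on homogeneous coordinates; working there avoids
    the case distinctions at infinity. *)
Definition act (a b c d : K) v : K * K := (a * v.1 + b * v.2, c * v.1 + d * v.2).
Definition scale (s : K) v : K * K := (s * v.1, s * v.2).

Lemma moebiusE a b c d p : moebius a b c d p =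
  point_of (act a b c d (homogeneous p)).
Proof. by case: p => [z|]; rewrite /point_of /= ?mulr1 ?mulr0 ?addr0. Qed.

Lemma point_of_scale s v : s != 0 -> point_of (scale s v) = point_of v.
Proof.
move=> s0; rewrite /point_of /= mulf_eq0 (negPf s0) /=; case: ifPn => // v0.
by congr Some; field; rewrite v0.
Qed.

Lemma homogeneous_point_of v : v != 0 -> exists2 s, s != 0 & v =
  scale s (homogeneous (point_of v)).
Proof.
case: v => a b; rewrite /point_of /scale /=; have [->|b0] := eqVneq b 0.
  move=> ab; exists a; rewrite /= ?mulr1 ?mulr0 //.
  by apply: contra_neq ab => ->.
by move=> _; exists b; rewrite //= mulr1 mulrC divfK.
Qed.

Lemma homogeneousK p : point_of (homogeneous p) = p.
Proof. by case: p => [z|]; rewrite /point_of /= ?oner_eq0 ?eqxx ?divr1. Qed.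

Lemma bracket_act a b c d v w :
  bracket (act a b c d v) (act a b c d w) = (a * d - b * c) * bracket v w.
Proof. by rewrite /bracket /=; ring. Qed.

Lemma bracket_scale s t v w : bracket (scale s v) (scale t w) = s * t * bracket v w.
Proof. by rewrite /bracket /=; ring. Qed.

Definition bracketP1 p q := bracket (homogeneous p) (homogeneous q).

Lemma bracketP1_neq0 p q : p != q -> bracketP1 p q != 0.
Proof.
case: p q => [z|] [w|];
  rewrite /bracketP1 /bracket //= ?mulr1 ?mulr0 ?mul1r ?sub0r ?subr0 ?oppr_eq0 ?oner_eq0 //.
by rewrite subr_eq0; apply: contra_neq => ->.
Qed.

Lemma act_neq0 a b c d v : a * d - b * c != 0 -> v != 0 -> act a b c d v != 0.
Proof.
move=> det; apply: contra_neq => -[ab cd].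
case: v ab cd => v1 v2 /= ab cd.
have e1 : (a * d - b * c) * v1 = 0.
  have -> : (a * d - b * c) * v1 = d * (a * v1 + b * v2) - b * (c * v1 + d *
    v2) by ring.
  by rewrite ab cd; ring.
have e2 : (a * d - b * c) * v2 = 0.
  have -> : (a * d - b * c) * v2 = a * (c * v1 + d * v2) - c * (a * v1 + b *
    v2) by ring.
  by rewrite ab cd; ring.
by congr pair; apply: (mulfI det); rewrite ?e1 ?e2 mulr0.
Qed.

Lemma homogeneous_neq0 p : homogeneous p != 0.
Proof. by case: p => [z|]; rewrite -[0]/(0, 0) xpair_eqE /= oner_eq0 ?andbF. Qed.

Lemma act_homogeneous a b c d p : a * d - b * c != 0 ->
  exists2 s, s != 0 & act a b c d (homogeneous p) =
    scale s (homogeneous (moebius a b c d p)).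
Proof. by move=> det; rewrite moebiusE;
  apply/homogeneous_point_of/act_neq0/homogeneous_neq0. Qed.

Lemma moebius_comp a b c d a' b' c' d' p : a * d - b * c != 0 ->
  moebius a' b' c' d' (moebius a b c d p) =
  moebius (a' * a + b' * c) (a' * b + b' * d) (c' * a + d' * c) (c' * b + d' * d) p.
Proof.
move=> det; have [s s0 hs] := act_homogeneous p det.
rewrite moebiusE -(point_of_scale _ s0) [RHS]moebiusE.
have -> : scale s (act a' b' c' d' (homogeneous (moebius a b c d p))) =
          act a' b' c' d' (act a b c d (homogeneous p)).
  by rewrite hs /act /scale /=; congr pair; ring.
by rewrite /act /=; congr point_of; congr pair; ring.
Qed.

Lemma moebius_scalar a p : a != 0 -> moebius a 0 0 a p = p.
Proof.
move=> a0; rewrite moebiusE -[RHS]homogeneousK -(point_of_scale (homogeneous p) a0).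
by rewrite /act /scale !mul0r addr0 add0r.
Qed.

End Moebius.

Section Fibers.
Local Open Scope classical_set_scope.
Local Open Scope ring_scope.
Variables (K : fieldType) (V : finType).
Implicit Types (p q : P1 K) (z : V -> P1 K).

Lemma moebius_trans z1 z2 z3 : moebius_equiv z1 z2 -> moebius_equiv z2 z3 ->
  moebius_equiv z1 z3.
Proof.
move=> [a [b [c [d [det h]]]]] [a' [b' [c' [d' [det' h']]]]].
exists (a' * a + b' * c), (a' * b + b' * d), (c' * a + d' * c), (c' * b + d' *
  d); split.
  have -> : (a' * a + b' * c) * (c' * b + d' * d) - (a' * b + b' * d) * (c' * a +
    d' * c) =
    (a' * d' - b' * c') * (a * d - b * c) by ring.
  by rewrite mulf_neq0.
by move=> v; rewrite h' h moebius_comp.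
Qed.

Lemma moebius_sym z1 z2 : moebius_equiv z1 z2 -> moebius_equiv z2 z1.
Proof.
move=> [a [b [c [d [det h]]]]]; exists d, (- b), (- c), a; split.
  by rewrite mulrNN mulrC.
move=> v; rewrite h moebius_comp //.
have -> : d * b + - b * d = 0 by ring.
have -> : - c * a + a * c = 0 by ring.
have -> : d * a + - b * c = a * d - b * c by ring.
have -> : - c * b + a * d = a * d - b * c by ring.
by rewrite moebius_scalar.
Qed.

Lemma moebius_equiv_inj z1 z2 : moebius_equiv z1 z2 -> injective z1 -> injective z2.
Proof.
move=> /moebius_sym[a [b [c [d [_ h]]]]] zi v w vw.
by apply: zi; rewrite !h vw.
Qed.

Lemma cross_ratioE p1 p2 p3 p4 : uniq [:: p1; p2; p3; p4] ->
  cross_ratio p1 p2 p3 p4 = (bracketP1 p3 p1 * bracketP1 p4 p2) /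
    (bracketP1 p3 p2 * bracketP1 p4 p1).
Proof.
case: p1 p2 p3 p4 => [z1|] [z2|] [z3|] [z4|] //=;
  rewrite ?inE ?eqxx ?orbT ?andbF //= => _;
  rewrite /bracketP1 /bracket /= ?mulr1 ?mulr0 ?mul1r ?mul0r ?subr0 ?sub0r ?mulNr ?mulrN ?mul1r ?mulr1 //.
- by rewrite invrN ?mulrNN ?mulrN ?opprK.
- by rewrite invrN ?mulrNN ?mulrN ?opprK.
Qed.

(** Each bracket is multiplied by the determinant and by one scalar per point, and
    all these factors cancel in the cross-ratio. *)
Lemma cross_ratio_moebius a b c d p1 p2 p3 p4 : a * d - b * c != 0 ->
  uniq [:: p1; p2; p3; p4] ->
  cross_ratio (moebius a b c d p1) (moebius a b c d p2) (moebius a b c d p3) (moebius a b c d p4)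
    = cross_ratio p1 p2 p3 p4.
Proof.
move=> det up.
have mI : injective (moebius a b c d).
  move=> p q pq; apply/eqP; apply: contraTT isT => /bracketP1_neq0.
  have [s s0 hs] := act_homogeneous p det; have [t t0 ht] := act_homogeneous q det.
  move=> /(mulf_neq0 det);
    rewrite /bracketP1 -bracket_act hs ht pq bracket_scale /bracket mulrC.
  by rewrite [X in X - _]mulrC [X in X - _]mulrC subrr mul0r eqxx.
rewrite !cross_ratioE //;
  last by rewrite -[X in uniq X]/(map (moebius a b c d) [:: p1; p2; p3;
  p4]) map_inj_uniq.
have [s1 s10 h1] := act_homogeneous p1 det; have [s2 s20 h2] :=
  act_homogeneous p2 det.
have [s3 s30 h3] := act_homogeneous p3 det; have [s4 s40 h4] :=
  act_homogeneous p4 det.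
have key p q s t : s != 0 -> t != 0 -> act a b c d (homogeneous p) =
  scale s (homogeneous (moebius a b c d p)) ->
   act a b c d (homogeneous q) = scale t (homogeneous (moebius a b c d q)) ->
   bracketP1 (moebius a b c d p) (moebius a b c d q) = (a * d - b * c) *
     bracketP1 p q / (s * t).
  move=> s0 t0 hs ht; rewrite /bracketP1 -bracket_act hs ht bracket_scale.
  by field; rewrite s0 t0.
rewrite (key _ _ _ _ s30 s10 h3 h1) (key _ _ _ _ s40 s20 h4 h2)
        (key _ _ _ _ s30 s20 h3 h2) (key _ _ _ _ s40 s10 h4 h1).
move: up; rewrite /= !inE !negb_or -!andbA => /and5P[_ _ n14 n23 /andP[_ _]].
have b32 : bracketP1 p3 p2 != 0 by rewrite bracketP1_neq0 // eq_sym.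
have b41 : bracketP1 p4 p1 != 0 by rewrite bracketP1_neq0 // eq_sym.
by field; rewrite b32 b41 s10 s20 s30 s40 det.
Qed.

(** The map is p |-> [p, p2] [p3, p1] / ([p, p1] [p3, p2]). *)
Lemma normal_moebius p1 p2 p3 : uniq [:: p1; p2; p3] -> exists a b c d,
  [/\ a * d - b * c != 0, moebius a b c d p1 = None, moebius a b c d p2 = Some 0 &
      moebius a b c d p3 = Some 1].
Proof.
rewrite /= !inE !negb_or => /and3P[/andP[n12 n13] n23 _].
have b31 : bracketP1 p3 p1 != 0 by rewrite bracketP1_neq0 // eq_sym.
have b32 : bracketP1 p3 p2 != 0 by rewrite bracketP1_neq0 // eq_sym.
have b21 : bracketP1 p2 p1 != 0 by rewrite bracketP1_neq0 // eq_sym.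
pose k := bracketP1 p3 p1; pose l := bracketP1 p3 p2.
exists ((homogeneous p2).2 * k), (- (homogeneous p2).1 * k),
  ((homogeneous p1).2 * l), (- (homogeneous p1).1 * l).
have E p : act ((homogeneous p2).2 * k) (- (homogeneous p2).1 *
  k) ((homogeneous p1).2 * l) (- (homogeneous p1).1 * l) (homogeneous p)
   = (bracketP1 p p2 * k, bracketP1 p p1 * l).
  by rewrite /act /bracketP1 /bracket; congr pair; ring.
have brr p : bracketP1 p p = 0 by rewrite /bracketP1 /bracket subrr.
split; rewrite ?moebiusE ?E.
- have -> : (homogeneous p2).2 * k * (- (homogeneous p1).1 * l) - -
    (homogeneous p2).1 * k * ((homogeneous p1).2 * l) = k * l * bracketP1 p2 p1.
    by rewrite /bracketP1 /bracket; ring.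
  by rewrite !mulf_neq0.
- by rewrite /point_of /= brr mul0r eqxx.
- by rewrite /point_of /= brr !mul0r mulf_eq0 (negPf b21) (negPf b32).
- rewrite /point_of /= mulf_eq0 (negPf b31) (negPf b32) /=; congr Some.
  by rewrite /k /l; field; rewrite b31 b32.
Qed.

Variables (E : finType) (o : E -> 4.-tuple V).
Hypothesis o_uniq : forall e, uniq (o e).

Lemma cr_map_uniq z e : injective z -> uniq [:: z (tnth (o e) (inord 0));
  z (tnth (o e) (inord 1));
  z (tnth (o e) (inord 2)); z (tnth (o e) (inord 3))].
Proof.
move=> zi; rewrite -[X in uniq X]/(map z (map (tnth (o e)) [:: inord 0; inord 1;
  inord 2; inord 3])).
rewrite map_inj_uniq // map_inj_uniq; last exact/tuple_uniqP.
by rewrite /= !inE -!val_eqE /= !inordK.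
Qed.

Lemma cr_map_moebius z1 z2 : injective z1 -> moebius_equiv z1 z2 ->
  cr_map o z1 =1 cr_map o z2.
Proof.
move=> zi [a [b [c [d [det h]]]]] e.
by rewrite /cr_map !h cross_ratio_moebius // cr_map_uniq.
Qed.

Variables v1 v2 v3 : V.
Hypothesis hv : uniq [:: v1; v2; v3].

Definition normalized z := [/\ z v1 = None, z v2 = Some 0 & z v3 = Some 1].

Lemma normalize z : injective z -> exists2 w, moebius_equiv z w & normalized w.
Proof.
move=> zi; have [] := @normal_moebius (z v1) (z v2) (z v3).
  by rewrite -[X in uniq X]/(map z [:: v1; v2; v3]) map_inj_uniq.
move=> a [b [c [d [det h1 h2 h3]]]].
by exists (fun v => moebius a b c d (z v)) => //; exists a, b, c, d.
Qed.

(** Each class contains a configuration with three prescribed points, and classes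
    sharing such a configuration are equal. *)
Lemma fiber_normalized (lam : E -> K) d : (cr_fiber o lam #= `I_d)%card ->
  exists p : 'I_d -> V -> P1 K, injective p /\
    forall i, [/\ injective (p i), normalized (p i) & cr_map o (p i) =1 lam].
Proof.
move=> /card_esym/card_set_bijP[f [ff fi _]].
have /choice[p hp] : forall i : 'I_d, exists w, [/\ f i w, injective w,
  normalized w & cr_map o w =1 lam].
  move=> i; have [[z0 /= z0i fE] [z + hz]] := ff i (ltn_ord i).
  rewrite -fE => z0z; have zi := moebius_equiv_inj z0z z0i.
  have [w zw nw] := normalize zi; exists w; split=> //.
  - exact: moebius_trans z0z zw.
  - exact: moebius_equiv_inj zw zi.
  - by move=> e; rewrite -(cr_map_moebius zi zw).
exists p; split=> [i j pij|i]; last by have [] := hp i.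
apply/ord_inj/fi; rewrite ?inE /=; [exact: ltn_ord|exact: ltn_ord|].
have [fi1 _ _ _] := hp i; have [fj1 _ _ _] := hp j; rewrite pij in fi1.
have [[zi zii fiE] _] := ff i (ltn_ord i); have [[zj zji fjE] _] :=
  ff j (ltn_ord j).
move: fi1 fj1; rewrite -fiE -fjE => hi hj.
apply/predeqP => w; split=> hw; apply: moebius_trans hw;
  apply: moebius_trans (moebius_sym _).
- exact: hj.
- exact: hi.
- exact: hi.
- exact: hj.
Qed.

End Fibers.

(** * Fractions and generic points of affine space *)

Section Fractions.
Local Open Scope ring_scope.
Local Open Scope quotient_scope.
Lemma fractionP (R : idomainType) (y : {fraction R}) :
  exists a b : R, b != 0 /\ y = FracField.tofrac a / FracField.tofrac b.
Proof.
elim/quotW: y => f; exists (frac f).1, (frac f).2.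
have d0 := denom_ratioP f; split=> //.
apply: (canRL (mulfK _)); first by rewrite tofrac_eq0.
rewrite -[LHS]/(FracField.mul _ _) !piE; apply/eqmodP => /=.
rewrite FracField.equivfE /FracField.mulf !numden_Ratio ?mulr1 ?oner_eq0 //.
by rewrite ?mulr1 mulrC.
Qed.
End Fractions.

Section Kronecker.
Local Open Scope ring_scope.

Lemma digits_inj B n (a b : 'I_n -> nat) :
  (forall i, a i < B)%N -> (forall i, b i < B)%N ->
  (\sum_(i < n) a i * B ^ i = \sum_(i < n) b i * B ^ i)%N -> a =1 b.
Proof.
elim: n a b => [|n IH] a b aB bB; first by move=> _ [].
have B0 : (0 < B)%N by apply: leq_ltn_trans (aB ord0).
rewrite !big_ord_recl expn0 !muln1.
(* All digits but the first carry a factor B. *)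
have shift (c : 'I_n.+1 -> nat) : (\sum_(i < n) c (lift ord0 i) * B ^ lift ord0 i =
   (\sum_(i < n) c (lift ord0 i) * B ^ i) * B)%N.
  by rewrite big_distrl /=; apply: eq_bigr => i _; rewrite /bump /= expnSr mulnA.
rewrite !shift => h.
have h0 : a ord0 = b ord0.
  have hm u v : (u < B -> (u + v * B) %% B = u)%N.
    by move=> uB; rewrite addnC modnMDl modn_small.
  by have := congr1 (modn^~ B) h; rewrite /= !hm.
move: h; rewrite h0 => /addnI/eqP; rewrite eqn_pmul2r // => /eqP h.
move=> i; case: (unliftP ord0 i) => [j ->|-> //].
by apply: (IH (fun i => a (lift ord0 i)) (fun i => b (lift ord0 i))).
Qed.

(** Kronecker substitution: x_i |-> k^(B^i) with B beyond all exponents sends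
    distinct monomials to distinct powers of k. *)
Lemma mpoly_nonroot (K : fieldType) n (F : {mpoly K[n]}) :
  injective (fun k : nat => k%:R : K) -> F != 0 -> exists l : 'I_n ->
    K, F.@[l] != 0.
Proof.
move=> char0 F0; pose B := msize F.
pose wt (m : 'X_{1..n}) := (\sum_(i < n) m i * B ^ i)%N.
pose q : {poly K} := \sum_(m <- msupp F) F@_m *: 'X^(wt m).
have mB (m : 'X_{1..n}) (i : 'I_n) : m \in msupp F -> (m i < B)%N.
  move=> /msize_mdeg_lt; apply: leq_ltn_trans.
  by rewrite mdegE (bigD1 i) //= leq_addr.
have q0 : q != 0.
  have [m mF] : exists m, m \in msupp F.
    case E : (msupp F) => [|m s]; last by exists m; rewrite mem_head.
    by move: F0; rewrite -msupp_eq0 E.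
  have : q`_(wt m) = F@_m.
    rewrite coef_sum (bigD1_seq m) //= coefZ coefXn eqxx mulr1 big_seq_cond big1 ?addr0 //.
    move=> m' /andP[m'F mm']; rewrite coefZ coefXn; case: eqP => [h|];
      last by rewrite mulr0.
    case/negP: mm'; apply/eqP/mnmP => i; apply/esym.
    by apply: (digits_inj _ _ h) => j; apply: mB.
  move=> qm; apply: contraTneq mF => q0; rewrite mcoeff_msupp negbK.
  by rewrite -qm q0 coef0.
have [k _] := nat_nonroot char0 q0.
rewrite /q horner_sum => hk; exists (fun i : 'I_n => k%:R ^+ (B ^ i)).
apply: contra_neq hk => h; rewrite -[RHS]h mevalE; apply: eq_bigr => m _.
rewrite hornerZ hornerXn; congr (_ * _); rewrite -prodrXr; apply: eq_bigr => i _.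
by rewrite -exprM mulnC.
Qed.

End Kronecker.

Section Separation.
Local Open Scope ring_scope.

(** Two distinct points are confused by the form with coefficients r^i only if r
    is a root of a nonzero polynomial.  The bound B does not depend on the points,
    so finitely many forms suffice for all families of d points. *)
Lemma separating_form (K : fieldType) n d (char0 : injective (fun k : nat =>
  k%:R : K)) :
  exists B : nat, forall p : 'I_d -> 'I_n -> K, injective p ->
    exists2 r : 'I_B, True & injective (fun k => \sum_(i < n) (r%:R) ^+ i * p k i).
Proof.
exists (\sum_(kl : 'I_d * 'I_d) n).+1 => p pinj.
pose q (kl : 'I_d * 'I_d) := \poly_(i < n) (if insub i is Some j then p kl.1 j -
  p kl.2 j else 0).
pose Q := \prod_(kl : 'I_d * 'I_d | kl.1 != kl.2) q kl.
have Q0 : Q != 0.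
  apply/prodf_neq0 => -[k l] /= kl; apply: contra_neq kl => qkl.
  apply/pinj/funext => i; apply/eqP; rewrite -subr_eq0; apply/eqP.
  by have /polyP/(_ i) := qkl; rewrite coef_poly ltn_ord valK coef0.
have sQ : (size Q <= (\sum_(kl : 'I_d * 'I_d) n).+1)%N.
  apply: leq_trans (size_poly_prod_leq _ _) _.
  apply: leq_trans (leq_subr _ _) _; rewrite ltnS.
  rewrite big_mkcond /=; apply: leq_sum => kl _; case: ifP => // _;
    exact: size_poly.
have [r rB Qr] := nat_nonroot char0 Q0.
exists (Ordinal (leq_trans rB sQ)) => // k l /= kl.
apply: contraNeq Qr => neq_kl; rewrite /Q horner_prod (bigD1 (k, l)) //=.
suff -> : (q (k, l)).[r%:R] = 0 by rewrite mul0r.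
rewrite horner_poly /= -[RHS](subrr (\sum_(i < n) r%:R ^+ i *
  p k i)) [in X in _ - X]kl -sumrB.
by apply: eq_bigr => i _; rewrite valK mulrBl ![_ * _ ^+ _]mulrC.
Qed.
End Separation.

(** * Evaluating rational functions at points *)

Section Evaluation.
Local Open Scope classical_set_scope.
Local Open Scope ring_scope.
(* L is the field of rational functions in n variables, known only through its
   universal embedding, which keeps the quotient construction out of the terms. *)
Variables (K : fieldType) (n : nat)
  (L : fieldType) (iota : {rmorphism {mpoly K[n]} -> L}).
Hypothesis iota_inj : injective iota.
Hypothesis iota_fraction : forall y, exists a b : {mpoly K[n]}, b != 0 /\ y =
  iota a / iota b.
Implicit Types (p : 'I_n -> K) (f g : L) (c d : K).

(** f is regular at p, where it takes the value c. *)
Definition evaluates p f c := exists a b : {mpoly K[n]},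
  [/\ b.@[p] != 0, f = iota a / iota b & c = a.@[p] / b.@[p]].

Lemma iota_eval_neq0 p (b : {mpoly K[n]}) : b.@[p] != 0 -> iota b != 0.
Proof. by rewrite (raddf_eq0 _ iota_inj); apply: contra_neq => ->;
  rewrite meval0. Qed.

Lemma evaluates_fun p f c d : evaluates p f c -> evaluates p f d -> c = d.
Proof.
move=> [a [b [b0 -> ->]]] [a' [b' [b'0 + ->]]].
have tb := iota_eval_neq0 b0; have tb' := iota_eval_neq0 b'0.
move=> /eqP; rewrite eqr_div // -!rmorphM (inj_eq iota_inj) => /eqP h.
by apply/eqP; rewrite eqr_div // -!mevalM h.
Qed.

Lemma evaluates_mpoly p (a : {mpoly K[n]}) : evaluates p (iota a) a.@[p].
Proof. by exists a, 1; rewrite meval1 oner_eq0 rmorph1 !divr1. Qed.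

Lemma evaluates_const p c : evaluates p (iota c%:MP) c.
Proof. by have := evaluates_mpoly p c%:MP; rewrite mevalC. Qed.

Lemma evaluates_nat p k : evaluates p k%:R k%:R.
Proof. by have := evaluates_mpoly p k%:R; rewrite !rmorph_nat. Qed.

Lemma evaluatesD p f g c d : evaluates p f c -> evaluates p g d ->
  evaluates p (f + g) (c + d).
Proof.
move=> [a [b [b0 -> ->]]] [a' [b' [b'0 -> ->]]].
have tb := iota_eval_neq0 b0; have tb' := iota_eval_neq0 b'0.
exists (a * b' + a' * b), (b * b'); split; first by rewrite mevalM mulf_neq0.
  by rewrite addf_div // rmorphD !rmorphM.
by rewrite addf_div // mevalD !mevalM.
Qed.

Lemma evaluatesM p f g c d : evaluates p f c -> evaluates p g d ->
  evaluates p (f * g) (c * d).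
Proof.
move=> [a [b [b0 -> ->]]] [a' [b' [b'0 -> ->]]].
exists (a * a'), (b * b'); split; first by rewrite mevalM mulf_neq0.
  by rewrite mulf_div !rmorphM.
by rewrite mulf_div !mevalM.
Qed.

Lemma evaluatesN p f c : evaluates p f c -> evaluates p (- f) (- c).
Proof.
move=> [a [b [b0 -> ->]]]; exists (- a), b; split=> //;
  first by rewrite rmorphN mulNr.
by rewrite mevalN mulNr.
Qed.

Lemma evaluatesB p f g c d : evaluates p f c -> evaluates p g d ->
  evaluates p (f - g) (c - d).
Proof. by move=> hf hg; apply: evaluatesD => //; exact: evaluatesN. Qed.

Lemma evaluatesV p f c : c != 0 -> evaluates p f c -> evaluates p f^-1 c^-1.
Proof.
move=> c0 [a [b [b0 fE cE]]]; move: c0; rewrite fE cE;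
  rewrite mulf_eq0 invr_eq0 negb_or => /andP[a0 _].
by exists b, a; rewrite !invf_div.
Qed.

Lemma evaluates_div p f g c d : d != 0 -> evaluates p f c -> evaluates p g d ->
  evaluates p (f / g) (c / d).
Proof. by move=> d0 hf hg; apply: evaluatesM => //; exact: evaluatesV. Qed.

Lemma evaluatesX p f c k : evaluates p f c -> evaluates p (f ^+ k) (c ^+ k).
Proof.
by move=> h; elim: k => [|k IH]; [exact: (evaluates_nat p 1)|rewrite !exprS;
  exact: evaluatesM].
Qed.

Lemma evaluates_sum p (I : Type) (r : seq I) (F : I -> L) (c : I -> K) :
  (forall i, evaluates p (F i) (c i)) ->
    evaluates p (\sum_(i <- r) F i) (\sum_(i <- r) c i).
Proof.
by move=> h; elim/big_rec2: _ => [|i x y _ hx];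
  [exact: (evaluates_nat p 0)|exact: evaluatesD].
Qed.

Lemma evaluates_prod p (I : Type) (r : seq I) (F : I -> L) (c : I -> K) :
  (forall i, evaluates p (F i) (c i)) ->
    evaluates p (\prod_(i <- r) F i) (\prod_(i <- r) c i).
Proof.
by move=> h; elim/big_rec2: _ => [|i x y _ hx];
  [exact: (evaluates_nat p 1)|exact: evaluatesM].
Qed.

Definition constants : set L := range (fun c : K => iota c%:MP).

Lemma gen_fraction (A : set L) : constants `<=` A ->
  (forall i, iota 'X_i \in gen A) ->
  forall f, f \in gen A.
Proof.
move=> cA XA f; have [a [b [b0 ->]]] := iota_fraction f.
have hA (p : {mpoly K[n]}) : iota p \in gen A.
  rewrite [p]mpolyE rmorph_sum rpred_sum // => m _.
  rewrite -mul_mpolyC rmorphM rpredM //; first by apply: mem_gen; apply: cA;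
    exists p@_m.
  by rewrite mpolyXE_id rmorph_prod rpred_prod // => i _; rewrite rmorphXn rpredX.
by rewrite rpred_div.
Qed.

Lemma char0_fraction : injective (fun k : nat => k%:R : K) ->
  injective (fun k : nat => k%:R : L).
Proof.
move=> char0 k l /= kl; apply: char0 => /=.
by apply: (@evaluates_fun (fun=> 0) l%:R); [rewrite -kl|]; exact: evaluates_nat.
Qed.

Section Substitution.
Variables (E : finType) (lam : E -> L).

Definition substitute (A : {mpoly K[#|E|]}) : L :=
  mmap (iota \o @mpolyC n K) (fun i => lam (enum_val i)) A.

Lemma substituteE A : substitute A =
  \sum_(m <- msupp A) iota (A@_m)%:MP * \prod_i lam (enum_val i) ^+ m i.
Proof. by []. Qed.

Lemma substituteB A B : substitute (A - B) = substitute A - substitute B.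
Proof. exact: rmorphB. Qed.
Lemma substituteM A B : substitute (A * B) = substitute A * substitute B.
Proof. exact: rmorphM. Qed.
Lemma substitute1 : substitute 1 = 1.
Proof. exact: rmorph1. Qed.
Lemma substitute_sum I (r : seq I) (F : I -> {mpoly K[#|E|]}) :
  substitute (\sum_(i <- r) F i) = \sum_(i <- r) substitute (F i).
Proof. exact: rmorph_sum. Qed.
Lemma substituteXn A k : substitute (A ^+ k) = substitute A ^+ k.
Proof. exact: rmorphXn. Qed.
Lemma substituteC c : substitute c%:MP = iota c%:MP.
Proof. by rewrite /substitute mmapC. Qed.
Lemma substituteX e : substitute 'X_(enum_rank e) = lam e.
Proof. by rewrite /substitute mmapX mmap1U enum_rankK. Qed.

Lemma evaluates_substitute p (l : E -> K) A : (forall e,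
  evaluates p (lam e) (l e)) ->
  evaluates p (substitute A) A.@[fun i => l (enum_val i)].
Proof.
move=> hl; rewrite substituteE mevalE; apply: evaluates_sum => m.
apply: evaluatesM; first exact: evaluates_const.
by apply: evaluates_prod => i; apply: evaluatesX.
Qed.

(** A semantic form of: only the variables in es occur in A. *)
Definition depends_on (es : seq E) (A : {mpoly K[#|E|]}) :=
  forall l l' : E -> K, {in es, l =1 l'} ->
    A.@[fun i => l (enum_val i)] = A.@[fun i => l' (enum_val i)].

Definition subst_ring es : set L := [set f | exists2 A, depends_on es A & f =
  substitute A].

Lemma subst_ringP es : is_ring (subst_ring es).
Proof.
split.
- by exists 1; [move=> l l' _; rewrite !meval1|rewrite substitute1].
- move=> _ _ [A hA ->] [B hB ->]; exists (A - B); last by rewrite substituteB.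
  by move=> l l' ll; rewrite !mevalB (hA _ _ ll) (hB _ _ ll).
- move=> _ _ [A hA ->] [B hB ->]; exists (A * B); last by rewrite substituteM.
  by move=> l l' ll; rewrite !mevalM (hA _ _ ll) (hB _ _ ll).
Qed.

Lemma gen_subst_ring es f : f \in gen (lam_values lam es `|` constants) ->
  fracs (subst_ring es) f.
Proof.
apply: gen_min; first exact/fracs_subfield/subst_ringP.
have [one _ _] := subst_ringP es.
move=> g hg; exists g, 1; rewrite oner_eq0 divr1; split=> //.
case: hg => [[e ees ->]|[c _ <-]].
  exists 'X_(enum_rank e); last by rewrite substituteX.
  by move=> l l' ll; rewrite !mevalXU enum_rankK ll.
by exists c%:MP; [move=> l l' _; rewrite !mevalC|rewrite substituteC].
Qed.

Lemma clear_denominators es k (f : 'I_k -> L) :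
  (forall i, f i \in gen (lam_values lam es `|` constants)) ->
  exists b (A : 'I_k -> {mpoly K[#|E|]}), [/\ b != 0, forall i,
    depends_on es (A i) &
    forall i, f i * b = substitute (A i)].
Proof.
move=> hf; have [|b [_ b0 hb]] := fracs_common (s := codom f) (subst_ringP es).
  by move=> _ /codomP[i ->]; apply: gen_subst_ring.
have /choice[A hA] : forall i, exists A, depends_on es A /\ f i * b = substitute A.
  by move=> i; have [A] := hb _ (codom_f f i); exists A.
by exists b, A; split=> // i; have [] := hA i.
Qed.

Hypothesis char0 : injective (fun k : nat => k%:R : K).
(** The family lam is dominant: its values lie in no hypersurface. *)
Hypothesis generic : forall A : {mpoly K[#|E|]}, A != 0 ->
  exists l p, A.@[fun i => l (enum_val i)] != 0 /\ forall e,
    evaluates p (lam e) (l e).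

Lemma substitute_inj A : substitute A = 0 -> A = 0.
Proof.
move=> A0; apply/eqP; apply: contraT => /generic[l [p [Al hl]]].
rewrite -(negbK (_ == 0)) in Al.
case/negP: Al; rewrite negbK; apply/eqP;
  apply: (evaluates_fun (evaluates_substitute A hl)).
by rewrite A0; exact: (evaluates_nat p 0).
Qed.

Lemma mpoly_nonroot_ext (A : {mpoly K[#|E|]}) : A != 0 ->
  exists l : E -> K, A.@[fun i => l (enum_val i)] != 0.
Proof.
move=> /(mpoly_nonroot char0)[l hl]; exists (fun e => l (enum_rank e)).
by rewrite (meval_eq (v2 := l)) // => i; rewrite enum_valK.
Qed.

(** An algebraic equation of lam_e over the other lam gives a nonzero polynomial
    relation between all of them, which a generic value would have to satisfy. *)
Lemma alg_indep_generic es : uniq es -> alg_indep lam constants es.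
Proof.
elim: es => //= e es IH /andP[ees /IH hes]; split=> //.
move=> /algP[p [p0 /polyOverP pA pe]].
have [b [A [b0 dA hA]]] := clear_denominators (f := fun i : 'I_(size p) =>
  p`_i) (fun i => pA i).
have sp : (0 < size p)%N by rewrite size_poly_gt0.
have ltp : ((size p).-1 < size p)%N by rewrite prednK.
pose i0 := Ordinal ltp.
pose R := \sum_(i < size p) A i * 'X_(enum_rank e) ^+ i.
have R0 : R = 0.
  apply: substitute_inj; rewrite substitute_sum.
  under eq_bigr => i _ do rewrite substituteM substituteXn substituteX -hA mulrAC.
  by rewrite -mulr_suml -horner_coef (rootP pe) mul0r.
have Ai0 : A i0 != 0.
  apply: contra_neq b0 => A0; have := hA i0; rewrite A0 [substitute 0]raddf0 =>
    /eqP.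
  by rewrite mulf_eq0 -lead_coefE lead_coef_eq0 (negPf p0) => /eqP.
have [l hl] := mpoly_nonroot_ext Ai0.
pose q := \poly_(i < size p) (if insub i is Some j then (A j).@[fun i =>
  l (enum_val i)] else 0).
have q0 : q != 0.
  by apply: contra_neq hl => /polyP/(_ i0); rewrite coef_poly ltp (valK i0) coef0.
have [k _] := nat_nonroot char0 q0.
case/negP; apply/eqP; pose l' (f : E) := if f == e then k%:R else l f.
transitivity R.@[fun i => l' (enum_val i)]; last by rewrite R0 meval0.
rewrite horner_poly raddf_sum; apply: eq_bigr => i _.
rewrite valK /= mevalM rmorphXn /= mevalXU enum_rankK /l' eqxx; congr (_ * _).
apply: (dA i l l') => f fes; rewrite /l'; case: (eqVneq f e) => // fe.
by rewrite -fe fes in ees.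
Qed.

End Substitution.
End Evaluation.

(** * The generic configuration and its cross-ratios *)

Section CrossRatioForms.
Local Open Scope classical_set_scope.
Local Open Scope ring_scope.

(** The points are pairwise distinct, so at most one of them is infinite; the value
    assigned to x for that point is immaterial because the factors containing it
    are absent. *)
Lemma cross_ratio_multilinear (L : fieldType) (B : set L) (q1 q2 q3 q4 :
  P1 L) (x1 x2 x3 x4 : L) :
  uniq [:: q1; q2; q3; q4] ->
  (forall q x, (q, x) \in [:: (q1, x1); (q2, x2); (q3, x3); (q4, x4)] ->
    q = None \/ q = Some x) ->
  exists g h, [/\ span B (box_monomials 1 [:: x1; x2; x3; x4]) g,
    span B (box_monomials 1 [:: x1; x2; x3; x4]) h,
      h != 0 & cross_ratio q1 q2 q3 q4 = g / h].
Proof.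
move=> uq hq.
have H i1 i2 i3 i4 : (i1 <= 1)%N -> (i2 <= 1)%N -> (i3 <= 1)%N -> (i4 <= 1)%N ->
    span B (box_monomials 1 [:: x1; x2; x3; x4]) (x1 ^+ i1 * (x2 ^+ i2 *
      (x3 ^+ i3 * (x4 ^+ i4 * 1)))).
  move=> h1 h2 h3 h4; apply: span_mem => /=.
  exists i1, (x2 ^+ i2 * (x3 ^+ i3 * (x4 ^+ i4 * 1))); split=> //.
  exists i2, (x3 ^+ i3 * (x4 ^+ i4 * 1)); split=> //.
  exists i3, (x4 ^+ i4 * 1); split=> //.
  by exists i4, 1; split.
have sB a b : span B (box_monomials 1 [:: x1; x2; x3; x4]) a ->
    span B (box_monomials 1 [:: x1; x2; x3; x4]) b ->
      span B (box_monomials 1 [:: x1; x2; x3; x4]) (a - b).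
  by move=> ha hb; apply: spanD => //; rewrite -mulN1r; apply: spanZ => //;
    rewrite rpredN rpred1.
have := hq q1 x1; have := hq q2 x2; have := hq q3 x3; have := hq q4 x4.
rewrite !inE !eqxx ?orbT => h4 h3 h2 h1.
have {}h1 := h1 isT; have {}h2 := h2 isT; have {}h3 := h3 isT; have {}h4 := h4 isT.
have E1 : x1 = x1 ^+ 1 * (x2 ^+ 0 * (x3 ^+ 0 * (x4 ^+ 0 * 1))) by ring.
have E2 : x2 = x1 ^+ 0 * (x2 ^+ 1 * (x3 ^+ 0 * (x4 ^+ 0 * 1))) by ring.
have E3 : x3 = x1 ^+ 0 * (x2 ^+ 0 * (x3 ^+ 1 * (x4 ^+ 0 * 1))) by ring.
have E4 : x4 = x1 ^+ 0 * (x2 ^+ 0 * (x3 ^+ 0 * (x4 ^+ 1 * 1))) by ring.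
have S1 := H 1%N 0%N 0%N 0%N isT isT isT isT; rewrite -E1 in S1.
have S2 := H 0%N 1%N 0%N 0%N isT isT isT isT; rewrite -E2 in S2.
have S3 := H 0%N 0%N 1%N 0%N isT isT isT isT; rewrite -E3 in S3.
have S4 := H 0%N 0%N 0%N 1%N isT isT isT isT; rewrite -E4 in S4.
have E34 : x3 * x4 = x1 ^+ 0 * (x2 ^+ 0 * (x3 ^+ 1 * (x4 ^+ 1 * 1))) by ring.
have E23 : x2 * x3 = x1 ^+ 0 * (x2 ^+ 1 * (x3 ^+ 1 * (x4 ^+ 0 * 1))) by ring.
have E14 : x1 * x4 = x1 ^+ 1 * (x2 ^+ 0 * (x3 ^+ 0 * (x4 ^+ 1 * 1))) by ring.
have E12 : x1 * x2 = x1 ^+ 1 * (x2 ^+ 1 * (x3 ^+ 0 * (x4 ^+ 0 * 1))) by ring.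
have E13 : x1 * x3 = x1 ^+ 1 * (x2 ^+ 0 * (x3 ^+ 1 * (x4 ^+ 0 * 1))) by ring.
have E24 : x2 * x4 = x1 ^+ 0 * (x2 ^+ 1 * (x3 ^+ 0 * (x4 ^+ 1 * 1))) by ring.
have S34 := H 0%N 0%N 1%N 1%N isT isT isT isT; rewrite -E34 in S34.
have S23 := H 0%N 1%N 1%N 0%N isT isT isT isT; rewrite -E23 in S23.
have S14 := H 1%N 0%N 0%N 1%N isT isT isT isT; rewrite -E14 in S14.
have S12 := H 1%N 1%N 0%N 0%N isT isT isT isT; rewrite -E12 in S12.
have S13 := H 1%N 0%N 1%N 0%N isT isT isT isT; rewrite -E13 in S13.
have S24 := H 0%N 1%N 0%N 1%N isT isT isT isT; rewrite -E24 in S24.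
have D a b : Some a != Some b :> P1 L -> b - a != 0.
  by rewrite subr_eq0; apply: contra_neq => ->.
move: uq; rewrite /= !inE !negb_or -!andbA =>
  /and5P[n12 n13 n14 n23 /and3P[n24 n34 _]].
clear hq H E1 E2 E3 E4 E34 E23 E14 E12 E13 E24.
case: h1 h2 h3 h4 => [?|?] [?|?] [?|?] [?|?]; subst;
  rewrite ?eqxx // in n12 n13 n14 n23 n24 n34 *.
- by exists (x4 - x2), (x3 - x2); split; [exact: sB|exact: sB|exact: D|].
- by exists (x3 - x1), (x4 - x1); split; [exact: sB|exact: sB|exact: D|].
- by exists (x4 - x2), (x4 - x1); split; [exact: sB|exact: sB|exact: D|].
- by exists (x3 - x1), (x3 - x2); split; [exact: sB|exact: sB|exact: D|].
exists ((x3 - x1) * (x4 - x2)), ((x3 - x2) * (x4 - x1)); split=> //.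
- have -> : (x3 - x1) * (x4 - x2) = (x3 * x4 - x2 * x3) - (x1 * x4 - x1 *
    x2) by ring.
  by apply: (sB _ _ (sB _ _ _ _) (sB _ _ _ _)).
- have -> : (x3 - x2) * (x4 - x1) = (x3 * x4 - x1 * x3) - (x2 * x4 - x1 *
    x2) by ring.
  by apply: (sB _ _ (sB _ _ _ _) (sB _ _ _ _)).
- by rewrite mulf_neq0 // D.
Qed.

Lemma tuple4E (T : Type) (t : 4.-tuple T) :
  val t = [:: tnth t (inord 0); tnth t (inord 1); tnth t (inord 2);
    tnth t (inord 3)].
Proof.
case: t => -[|a [|b [|c [|d [|? ?]]]]] //= i.
by rewrite !(tnth_nth a) !inordK.
Qed.
End CrossRatioForms.

Section GenericFiber.
Local Open Scope classical_set_scope.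
Local Open Scope ring_scope.
Variables (K : fieldType) (V E : finType) (o : E -> 4.-tuple V) (v1 v2 v3 : V).
Hypothesis char0 : injective (fun k : nat => k%:R : K).
Hypothesis o_uniq : forall e, uniq (o e).
Hypothesis hv : uniq [:: v1; v2; v3].
Let S : {set V} := finset (fun v => v \in [:: v1; v2; v3]).
Let W := {v : V | v \notin S}.
Let n := #|{: W}|.
Variables (L : fieldType) (iota : {rmorphism {mpoly K[n]} -> L}).
Hypothesis iota_inj : injective iota.
Hypothesis iota_fraction : forall y, exists a b : {mpoly K[n]}, b != 0 /\ y =
  iota a / iota b.

Implicit Types (z : V -> P1 K) (p : 'I_n -> K).

(** The coordinates with v1, v2, v3 at infinity, 0 and 1 and independent variables
    elsewhere.  The test is also false at v2, which gives 0; the value at v1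
    never enters a cross-ratio. *)
Definition generic_coord (v : V) : L :=
  if insub v is Some a then iota 'X_(enum_rank (a : W)) else (v == v3)%:R.
Definition generic_config (v : V) : P1 L :=
  if v == v1 then None else Some (generic_coord v).
Definition coords (z : V -> P1 K) : 'I_n -> K := fun i =>
  odflt 0 (z (val (enum_val i))).

Definition evaluatesP1 p (f : P1 L) (c : P1 K) : Prop :=
  match f, c with
  | None, None => True
  | Some f, Some c => evaluates iota p f c
  | _, _ => False
  end.

Lemma inS v : (v \in S) = [|| v == v1, v == v2 | v == v3].
Proof. by rewrite inE !inE. Qed.

Lemma finite_coord z v : injective z -> normalized v1 v2 v3 z -> v != v1 ->
  z v = Some (odflt 0 (z v)).
Proof.
move=> zi [z1 _ _] vv1; case zv : (z v) => //; case/negP: vv1; apply/eqP; apply: zi.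
by rewrite zv z1.
Qed.

Lemma evaluates_config z v : injective z -> normalized v1 v2 v3 z ->
  evaluatesP1 (coords z) (generic_config v) (z v).
Proof.
move=> zi nz; have [z1 z2 z3] := nz; rewrite /generic_config.
case: (eqVneq v v1) => [->|vv1]; first by rewrite z1.
rewrite (finite_coord zi nz vv1) /= /generic_coord; case: insubP => [a _ av|].
  have := evaluates_mpoly iota (coords z) 'X_(enum_rank a).
  by rewrite mevalXU /coords enum_rankK av.
rewrite negbK inS (negPf vv1) /=; case: (eqVneq v v3) => [->|_].
  by rewrite z3 /= => _; exact: evaluates_nat 1.
by rewrite orbF => /eqP->; rewrite z2; exact: evaluates_nat 0.
Qed.

Lemma coords_inj z z' : injective z -> normalized v1 v2 v3 z ->
  injective z' -> normalized v1 v2 v3 z' -> coords z = coords z' -> z = z'.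
Proof.
move=> zi nz zi' nz' zz'; apply/funext => v.
have [z1 z2 z3] := nz; have [z1' z2' z3'] := nz'.
have [vS|vS] := boolP (v \in S).
  by move: vS; rewrite inS => /or3P[] /eqP->; rewrite ?z1 ?z2 ?z3 ?z1' ?z2' ?z3'.
have vv1 : v != v1 by move: vS; rewrite inS negb_or => /andP[].
rewrite (finite_coord zi nz vv1) (finite_coord zi' nz' vv1).
have := congr1 (fun f => f (enum_rank (Sub v vS : W))) zz'.
by rewrite /coords enum_rankK /= => ->.
Qed.

Lemma evaluates_cross_ratio p f1 f2 f3 f4 c1 c2 c3 c4 :
  evaluatesP1 p f1 c1 -> evaluatesP1 p f2 c2 -> evaluatesP1 p f3 c3 ->
    evaluatesP1 p f4 c4 ->
  uniq [:: c1; c2; c3; c4] ->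
  evaluates iota p (cross_ratio f1 f2 f3 f4) (cross_ratio c1 c2 c3 c4).
Proof.
have D a b : Some a != Some b :> P1 K -> b - a != 0.
  by rewrite subr_eq0; apply: contra_neq => ->.
move=> h1 h2 h3 h4; rewrite /= !inE !negb_or -!andbA =>
  /and5P[n12 n13 n14 n23 /and3P[n24 n34 _]].
case: f1 c1 h1 n12 n13 n14 => [f1|] [c1|] //= h1 n12 n13 n14;
case: f2 c2 h2 n12 n23 n24 => [f2|] [c2|] //= h2 n12 n23 n24;
case: f3 c3 h3 n13 n23 n34 => [f3|] [c3|] //= h3 n13 n23 n34;
case: f4 c4 h4 n14 n24 n34 => [f4|] [c4|] //= h4 n14 n24 n34;
apply: evaluates_div => //; rewrite ?mulf_neq0 ?D //;
by do ?[apply: evaluatesM => //|apply: evaluatesB => //].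
Qed.

Let lam := cr_map o generic_config.

Lemma evaluates_lam z e : injective z -> normalized v1 v2 v3 z ->
  evaluates iota (coords z) (lam e) (cr_map o z e).
Proof.
by move=> zi nz; apply: evaluates_cross_ratio;
  [exact: evaluates_config..|exact: (cr_map_uniq o_uniq e zi)].
Qed.

Lemma generic_config_inj z : injective z -> normalized v1 v2 v3 z ->
  injective generic_config.
Proof.
move=> zi nz v w vw; apply: (zi).
have := evaluates_config w zi nz; have := evaluates_config v zi nz; rewrite vw.
case: (generic_config w) (z v) (z w) => [f|] [c|] [c'|] //= hc hc'.
by rewrite (evaluates_fun iota_inj hc hc').
Qed.

Variable d : nat.
Hypothesis hd : is_cr_degree K o d.
Hypothesis d0 : (0 < d)%N.

(** The fiber is taken over a point outside the bad locus F of the degree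
    hypothesis, the zeros of A, and the values 0 and 1. *)
Lemma generic_points (A : {mpoly K[#|E|]}) : A != 0 -> exists l (z : 'I_d -> V ->
  P1 K),
  [/\ A.@[fun i => l (enum_val i)] != 0, injective z &
      forall k, [/\ injective (z k),
        normalized v1 v2 v3 (z k) & cr_map o (z k) =1 l]].
Proof.
have [F F0 hF] := hd => A0.
(* The last product keeps the values away from 0 and 1. *)
pose Q : {mpoly K[#|E|]} := A * F * \prod_e ('X_(enum_rank e) *
  ('X_(enum_rank e) - 1)).
have Q0 : Q != 0.
  rewrite !mulf_neq0 //; apply/prodf_neq0 => e _; rewrite mulf_neq0 //.
    apply/eqP => /(congr1 (meval (fun=> 1))); rewrite mevalXU meval0; apply/eqP;
      exact: oner_neq0.
  apply/eqP => /(congr1 (meval (fun=> 0)));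
    rewrite mevalB mevalXU meval1 meval0 sub0r.
  by apply/eqP; rewrite oppr_eq0 oner_eq0.
have [l] := mpoly_nonroot_ext char0 Q0.
rewrite !mevalM rmorph_prod /= !mulf_eq0 !negb_or -!andbA =>
  /and3P[Al Fl /prodf_neq0 hl].
have [z [zi hz]] : exists p : 'I_d -> V -> P1 K, injective p /\
    forall i, [/\ injective (p i), normalized v1 v2 v3 (p i) & cr_map o (p i) =1 l].
  apply: fiber_normalized => //; apply: hF => // e.
  have := hl e isT; rewrite mevalM mevalB meval1 !mevalXU enum_rankK mulf_eq0 negb_or subr_eq0.
  by move=> /andP[].
by exists l, z.
Qed.

Lemma generic_attained (A : {mpoly K[#|E|]}) : A != 0 ->
  exists l p, A.@[fun i => l (enum_val i)] != 0 /\ forall e,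
    evaluates iota p (lam e) (l e).
Proof.
move=> /generic_points[l [z [Al _ hz]]]; have [zi nz cz] := hz (Ordinal d0).
by exists l, (coords (z (Ordinal d0))); split=> // e; rewrite -cz;
  exact: evaluates_lam.
Qed.

Lemma config_inj : injective generic_config.
Proof.
have [|l [z [_ _ hz]]] := generic_points (A := 1); first exact: oner_neq0.
have [zi nz _] := hz (Ordinal d0); exact: generic_config_inj zi nz.
Qed.

(** If the powers of every candidate linear form were dependent over K(lam), then
    over a generic value of lam all these relations would specialize to nonzero
    polynomials of degree less than d.  But one of the forms takes d distinct
    values on the d points of that fiber, all of them roots. *)
Lemma separating_powers : exists u : L,
  lin_indep (lam_values lam (enum E) `|` constants iota) (fun j : 'I_d => u ^+ j).
Proof.
have [B hB] := separating_form n d char0.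
apply: contrapT => nou.
pose u (r : 'I_B) : L := \sum_(i < n) (r%:R) ^+ i * iota 'X_i.
have /choice[A hA] : forall r : 'I_B, exists Aj : ('I_d -> {mpoly K[#|E|]}) * 'I_d,
    Aj.1 Aj.2 != 0 /\ \sum_j substitute iota lam (Aj.1 j) * u r ^+ j = 0.
  move=> r; apply: contrapT => noA; apply: nou; exists (u r) => c cK c0 j.
  have [b [A [b0 _ hA]]] := clear_denominators cK.
  apply/eqP; apply: contra_notT noA => cj0; exists (A, j) => /=; split.
    apply: contra_neq cj0 => Aj0; have := hA j;
      rewrite Aj0 [substitute _ _ 0]raddf0 => /eqP.
    by rewrite mulf_eq0 (negPf b0) orbF => /eqP.
  under eq_bigr => i _ do rewrite -hA mulrAC.
  by rewrite -mulr_suml c0 mul0r.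
have [|l [z [Al zi hz]]] := generic_points (A := \prod_r (A r).1 (A r).2).
  by apply/prodf_neq0 => r _; case: (hA r).
pose p k := coords (z k).
have pinj : injective p.
  move=> k k' kk'; apply: zi; have [zi1 nz1 _] := hz k; have [zi2 nz2 _] := hz k'.
  exact: coords_inj kk'.
have [r _ rinj] := hB p pinj.
have [Ar0 hAr] := hA r.
(* The relation for the form of index r, specialized at l. *)
pose q := \poly_(j < d) (if insub j is Some i then ((A r).1 i).@[fun i =>
  l (enum_val i)] else 0).
have q0 : q != 0.
  move: Al; rewrite rmorph_prod /= => /prodf_neq0/(_ r isT); apply: contra_neq.
  by move=> /polyP/(_ (A r).2); rewrite coef_poly ltn_ord valK coef0.
pose rs := [seq \sum_(i < n) (r%:R) ^+ i * p k i | k <- enum 'I_d].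
have : (size rs < size q)%N.
  apply: max_poly_roots => //; last by rewrite map_inj_uniq // enum_uniq.
  apply/allP => _ /mapP[k _ ->]; apply/rootP; rewrite horner_poly.
  have [zi1 nz1 cz1] := hz k.
  apply: (@evaluates_fun _ _ _ _ iota_inj (p k) 0);
    last exact: (evaluates_nat iota _ 0).
  rewrite -hAr; apply: (evaluates_sum iota_inj) => j; rewrite valK;
    apply: evaluatesM.
    by apply: (evaluates_substitute iota_inj) => e; rewrite -cz1;
      exact: evaluates_lam.
  apply: evaluatesX; apply: (evaluates_sum iota_inj) => i; apply: evaluatesM.
    by apply: evaluatesX; exact: evaluates_nat.
  by have := evaluates_mpoly iota (p k) 'X_i; rewrite mevalXU.
by rewrite size_map size_enum_ord ltnNge size_poly.
Qed.

Theorem cr_degree_le_matchings : #|~: S| = #|E| ->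
  (d <= size (matchings (fun e => o e : seq V) (enum E) (~: S)))%N.
Proof.
move=> cS; have [u iu] := separating_powers.
have char0L := char0_fraction iota_inj char0.
apply: (degree_le_matchings (x := generic_coord) char0L _ _ _ _ _ _ iu) => //.
- move=> e; have [||g [h [hg hh h0 hgh]]] :=
    @cross_ratio_multilinear L (constants iota)
    (generic_config (tnth (o e) (inord 0))) (generic_config (tnth (o e) (inord 1)))
    (generic_config (tnth (o e) (inord 2))) (generic_config (tnth (o e) (inord 3)))
    (generic_coord (tnth (o e) (inord 0))) (generic_coord (tnth (o e) (inord 1)))
    (generic_coord (tnth (o e) (inord 2))) (generic_coord (tnth (o e) (inord 3))).
  + exact: (cr_map_uniq o_uniq e config_inj).
  + move=> q x; rewrite !inE => /or4P[] /eqP[-> ->]; rewrite /generic_config;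
      by case: eqP; [left|right].
  + by exists g, h; rewrite tuple4E.
- move=> v; rewrite finset.in_setC negbK => vS; rewrite /generic_coord.
  case: insubP => [a|_]; first by rewrite vS.
  exact: rpred_nat.
- apply: (gen_fraction iota_fraction) => [c|i]; first by right.
  apply: mem_gen; left; exists (val (enum_val i)) => //.
  by rewrite /generic_coord valK enum_valK.
- by rewrite cS cardE.
- apply: (alg_indep_generic iota_inj char0 generic_attained); exact: enum_uniq.
Qed.
End GenericFiber.

Theorem theorem1p1 (R : realType) (n : nat) (V E : finType)
    (T : hypergraph4 V E) (hn : 4 <= n) (hV : #|V| = n) (hE : #|E| = n - 3)
    (o : E -> 4.-tuple V) (ho : edge_ordering T o)
    (dT : nat) (hdT : is_cr_degree R[i] o dT)
    (v1 v2 v3 : V) (hv : uniq [:: v1; v2; v3]) :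
  dT <= num_perfect_matchings
          (delete_left (incidence_graph T) [set v1; v2; v3]).
Proof.
have [->//|d0] := posnP dT.
have SE : finset (fun v => v \in [:: v1; v2; v3]) = [set v1; v2; v3].
  by apply/setP => v; rewrite !inE orbA.
have cS : #|~: [set v1; v2; v3]| = #|E|.
  rewrite cardsCs finset.setCK hV hE -SE; congr (_ - _).
  by rewrite cardsE; have /card_uniqP := hv.
have [e0 _] : exists e : E, e \in E by apply/card_gt0P; rewrite hE; lia.
have o_uniq e : uniq (o e) := (ho e).1.
apply: leq_trans (matchings_le_perfect (adj := fun e => o e) e0 v1 o_uniq _ cS).
  have char0 : injective (fun k : nat => (k%:R : R[i])%R).
    by move=> j k /eqP; rewrite Num.Theory.eqr_nat => /eqP.
  rewrite -SE.
  apply: (cr_degree_le_matchings char0 o_uniq hv (iota :=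
    @FracField.tofrac _) _ _ hdT d0).
  - by move=> a b /eqP; rewrite tofrac_eq => /eqP.
  - exact: fractionP.
  - by rewrite SE.
by move=> e v; rewrite /incidence_graph (ho e).2.
Qed.
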